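(* Let $k\ge 1$. Let $\mathcal{M}$ be a von Neumann algebra generated by self-adjoint elements $X_1,\ldots,X_k$ and let $\mathcal{N}$ be a von Neumann algebra generated by self-adjoint elements $Y_1,\ldots,Y_k$. Let $\tau$ be a normal, faithful, tracial state on $\mathcal{M}$ and let $\chi$ be a normal, faithful, tracial state on $\mathcal{N}$. Let $c<d$ be real numbers and suppose that for all $n\in\mathbb{N}$ and all self-adjoint matrices $a_1,\ldots,a_k\in\mathbb{M}_n(\mathbb{C})$ whose spectra are contained in the interval $[c,d]$, the distributions of $\sum_{i=1}^k a_i\otimes X_i$ and $\sum_{i=1}^k a_i\otimes Y_i$ are the same. Then there exists an isomorphism of von Neumann algebras ($*$-isomorphism) $\phi:\mathcal{M}\to\mathcal{N}$ such that $\phi(X_i)=Y_i$ for all $i\in\{1,\ldots,k\}$ and $\chi\circ\phi=\tau$.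
   Context: $\mathbb{M}_n(\mathbb{C})$ is the algebra of $n\times n$ complex matrices and $\mathrm{tr}_n=\frac1n\mathrm{Tr}$ is its normalized trace. The distribution of a self-adjoint element $T$ of a von Neumann algebra with normal faithful tracial state $\sigma$ is the compactly supported Borel probability measure $\mu_T$ on $\mathbb{R}$ with $\sigma(T^p)=\int t^p\,d\mu_T(t)$ for all $p\ge 1$ (so equality of distributions means equality of all moments). The distribution of $\sum_i a_i\otimes X_i\in\mathbb{M}_n(\mathbb{C})\otimes\mathcal{M}$ is taken with respect to $\mathrm{tr}_n\otimes\tau$, and that of $\sum_i a_i\otimes Y_i\in\mathbb{M}_n(\mathbb{C})\otimes\mathcal{N}$ with respect to $\mathrm{tr}_n\otimes\chi$. *)

(* Defs.v *)
From HB Require Import structures.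
From mathcomp Require Import all_boot all_order all_algebra complex.
From mathcomp Require Import ring.
From mathcomp Require Import boolp classical_sets functions reals topology normedtype sequences.
Set Implicit Arguments. Unset Strict Implicit. Unset Printing Implicit Defensive.
Import Order.TTheory GRing.Theory Num.Theory numFieldNormedType.Exports.
Local Open Scope classical_set_scope.
Local Open Scope ring_scope.

Section DotForm.
Context {C : numClosedFieldType} {U : lmodType C} (form : {dot U for @Num.conj C}).
Local Notation "''[' x , y ]" := (form x y).

Lemma addJ_real (z : C) : z + z^* \is Num.real.
Proof. by apply/CrealP; rewrite rmorphD/= conjCK addrC. Qed.

Lemma addJ_le (z : C) : z + z^* <= `|z| *+ 2.
Proof.
apply: le_trans (real_ler_norm (addJ_real z)) _.
by rewrite (le_trans (ler_normD _ _))// norm_conjC -mulr2n.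
Qed.

Lemma dot_variation (f : U -> C) (u x : U) : scalar f -> x != 0 ->
  let q z := '[z, z] - (f z + (f z)^*) in
  exists z, q z = q u - `|'[x, u] - f x| ^+ 2 / '[x, x].
Proof.
move=> f_linear x0 q.
set w := '[x, u] - f x; pose s := '[x, x]; pose t := - (w^* / s).
have s0 : 0 < s by rewrite dnorm_gt0.
have sN0 : s != 0 by rewrite gt_eqF.
have tw : t * w = - (`|w| ^+ 2 / s) by rewrite /t mulNr normCK mulrAC (mulrC w).
have sR : s \is Num.real by rewrite ger0_real// ltW.
have twJ : (t * w)^* = t * w.
  by apply: conj_Creal; rewrite tw rpredN rpredM ?rpredV ?rpredX ?normr_real.
have ts : `|t| ^+ 2 * s = `|w| ^+ 2 / s.
  rewrite /t normrN normrM norm_conjC normfV (ger0_norm (ltW s0)).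
  by field.
exists (t *: x + u).
rewrite /q dnormD dnormZ/= linearZl_LR/= f_linear -/s ts.
have fxE : f x = '[x, u] - w by rewrite /w opprB addrC subrK.
rewrite fxE /= mulrBr !(rmorphD, rmorphN)/= twJ tw opprK.
set a := t * _; set b := _ / _; set c := '[u, u]; set e := f u.
ring.
Qed.

Lemma dot_CauchySchwarz x y : `|'[x, y]| ^+ 2 <= '[x, x] * '[y, y].
Proof.
have [->|y0] := eqVneq y 0.
  by rewrite linear0r normr0 expr0n/= mulr_ge0// dnorm_ge0.
have yy : 0 < '[y, y] by rewrite dnorm_gt0.
have := dnorm_ge0 form (x - ('[x, y] / '[y, y]) *: y).
rewrite dnormB dnormZ /= linearZr_LR /=.
rewrite normrM exprMn normfV (ger0_norm (ltW yy)).
set s := '[y, y] in yy *; have s0 : s != 0 by rewrite gt_eqF.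
have sJ : s^* = s by apply: conj_Creal; rewrite ger0_real// ltW.
have -> : ('[x, y] / s)^* * '[x, y] = `|'[x, y]| ^+ 2 / s.
  by rewrite normCK rmorphM/= fmorphV/= sJ; field.
have -> : (`|'[x, y]| ^+ 2 / s)^* = `|'[x, y]| ^+ 2 / s.
  by apply: conj_Creal; rewrite rpredM ?rpredV ?rpredX ?normr_real// ger0_real// ltW.
rewrite (_ : _ - _ = '[x, x] - `|'[x, y]| ^+ 2 / s); last by field.
by rewrite subr_ge0 ler_pdivrMr.
Qed.
End DotForm.

Local Open Scope complex_scope.

HB.instance Definition _ (R : realType) := NormedModule.copy R[i] R[i]^o.

(* The inner product is linear in its first argument and conjugate-linear in
   the second one. *)
HB.mixin Record CompleteNormedModule_isHilbert (R : realType) H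
    of CompleteNormedModule R[i] H := {
  inner : {dot H for @Num.conj R[i]};
  inner_normE : forall x : H, inner x x = `|x| ^+ 2 }.

#[short(type="hilbertType")]
HB.structure Definition Hilbert (R : realType) :=
  {H of CompleteNormedModule R[i] H & CompleteNormedModule_isHilbert R H}.


Section BoundedOperators.
Context {R : realType} {H : hilbertType R}.

Definition bounded_op : {pred H -> H} :=
  [pred T : H -> H | `[< linear T /\ continuous T >]].

Fact bounded_op_submod : submod_closed bounded_op.
Proof.
split=> [|a S T].
  apply/asboolP; split => [b x y|x].
    by rewrite (_ : (0 : H -> H) = fun=> 0)// scaler0 addr0.
  exact: cvg_cst.
move=> /asboolP[lS cS] /asboolP[lT cT]; apply/asboolP; split => [b x y|x].
  have E z : (a *: S + T) z = a *: S z + T z by [].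
  rewrite !E lS lT.
  by rewrite !scalerDr !scalerA (mulrC a) addrACA.
apply: cvgD (cT x).
exact: (@cvgZl_tmp _ _ _ _ _ a S _ (cS x)).
Qed.

HB.instance Definition _ :=
  GRing.isSubmodClosed.Build R[i] (H -> H) bounded_op bounded_op_submod.

Record bop : Type := BOp { bop_fun :> H -> H; bop_funP : bop_fun \in bounded_op }.
HB.instance Definition _ := [isSub for bop_fun].
HB.instance Definition _ := [Choice of bop by <:].
HB.instance Definition _ := [SubChoice_isSubLmodule of bop by <:].
End BoundedOperators.
Arguments bop {R} H.

Section BoundedOperatorRing.
Context {R : realType} {H : hilbertType R}.
Implicit Types S T : bop H.

Lemma bop_linear T : linear T.
Proof. by have /asboolP[] := bop_funP T. Qed.

Lemma bop_continuous T : continuous T.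
Proof. by have /asboolP[] := bop_funP T. Qed.

Lemma bopP S T : S =1 T -> S = T.
Proof. by move=> ST; apply/val_inj/funext. Qed.

Fact bop_id_subproof : id \in @bounded_op R H.
Proof. by apply/asboolP; split=> // x; exact: cvg_id. Qed.

Fact bop_comp_subproof S T : S \o T \in @bounded_op R H.
Proof.
apply/asboolP; split=> [a x y|x] /=; first by rewrite !bop_linear.
apply: continuous_comp; exact: bop_continuous.
Qed.

Definition bop_one : bop H := BOp bop_id_subproof.
Definition bop_mul S T : bop H := BOp (bop_comp_subproof S T).

Fact bop_mulA : associative bop_mul. Proof. by move=> S T U; exact: bopP. Qed.
Fact bop_mul1 : left_id bop_one bop_mul. Proof. by move=> S; exact: bopP. Qed.
Fact bop_mulr1 : right_id bop_one bop_mul. Proof. by move=> S; exact: bopP. Qed.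
Fact bop_mulDl : left_distributive bop_mul +%R.
Proof. by move=> S T U; exact: bopP. Qed.
Fact bop_mulDr : right_distributive bop_mul +%R.
Proof.
move=> S T U; apply: bopP => x.
by have := bop_linear S 1 (T x) (U x); rewrite !scale1r.
Qed.

HB.instance Definition _ := GRing.Zmodule_isPzRing.Build (bop H)
  bop_mulA bop_mul1 bop_mulr1 bop_mulDl bop_mulDr.

HB.instance Definition _ (T : bop H) :=
  GRing.isLinear.Build R[i] H H *:%R (bop_fun T) (bop_linear T).
End BoundedOperatorRing.

Section Riesz.
Context {R : realType} {H : hilbertType R}.
Local Notation "''[' x , y ]" := (inner x y).
Implicit Types x y z : H.

Lemma CauchySchwarz x y : `|'[x, y]| <= `|x| * `|y|.
Proof.
rewrite -ler_sqr ?nnegrE ?mulr_ge0// exprMn -!inner_normE.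
exact: dot_CauchySchwarz.
Qed.

Context (f : H -> R[i]).
Context (f_linear : scalar f).
Context (f_bounded : exists M : R[i], forall x, `|f x| <= M * `|x|).

Let q x : R := complex.Re ('[x, x] - (f x + (f x)^*%R)).

Let qE x : (q x)%:C = `|x| ^+ 2 - (f x + (f x)^*%R).
Proof.
rewrite /q RRe_real ?inner_normE// rpredB ?rpredX ?normr_real//.
exact: addJ_real.
Qed.

Let q_has_inf : has_inf (range q).
Proof.
split; first by exists (q 0), 0.
have [M fM] := f_bounded.
exists (- (complex.Re `|M|) ^+ 2) => _ [x _ <-].
have eM : (complex.Re `|M|)%:C = `|M| by rewrite RRe_real ?normr_real.
rewrite -lecR qE (_ : (- _)%:C = - `|M| ^+ 2); last first.
  by rewrite -{2}eM -rmorphXn -rmorphN.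
have fMx : `|f x| <= `|M| * `|x|.
  have Mx0 : 0 <= M * `|x| by apply: le_trans (fM x).
  by rewrite -[`|x|]normr_id -normrM ger0_norm.
have fJ : f x + (f x)^*%R <= `|M| * `|x| *+ 2.
  by apply: le_trans (addJ_le _) _; rewrite lerMn2r.
apply: le_trans (lerB (lexx _) fJ).
rewrite -subr_ge0 (_ : _ - _ = (`|x| - `|M|) ^+ 2); last by ring.
by rewrite real_exprn_even_ge0// rpredB ?normr_real.
Qed.

Lemma riesz_approx (d : R) : 0 < d ->
  exists u, forall x, `|f x - '[x, u]| <= d%:C * `|x|.
Proof.
move=> d0.
have f0 : f 0 = 0 by have := f_linear (-1) 0 0; rewrite scaler0 addr0 mulN1r addNr.
have [|_ [u _ <-] qu] := inf_adherent (_ : 0 < d ^+ 2) q_has_inf.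
  by rewrite exprn_gt0.
exists u => x.
have [->|x0] := eqVneq x 0; first by rewrite f0 linear0l normr0 mulr0 subr0 normr0.
have [z qz] := dot_variation inner u f_linear x0.
have dC : 0 <= d%:C by rewrite ler0c ltW.
rewrite distrC -ler_sqr ?nnegrE ?mulr_ge0// exprMn.
have x2 : 0 < `|x| ^+ 2 by rewrite exprn_gt0 ?normr_gt0.
rewrite -ler_pdivrMr// -inner_normE.
have {qz} : (q z)%:C = (q u)%:C - `|'[x, u] - f x| ^+ 2 / '[x, x].
  by rewrite !qE -!inner_normE.
have : inf (range q) <= q z by have [_ lb] := q_has_inf; apply: (ge_inf lb); exists z.
rewrite -lecR => mz' e; move: mz'; rewrite e lerBrDl -lerBrDr => /le_trans; apply.
rewrite -rmorphXn -rmorphB lecR lerBlDr addrC; exact: ltW.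
Qed.

Lemma riesz : exists u, forall x, f x = '[x, u].
Proof.
have /choice [u fu] : forall n : nat, exists u, forall x,
  `|f x - '[x, u]| <= (n.+1%:R^-1 : R)%:C * `|x|.
  by move=> n; apply: riesz_approx; rewrite invr_gt0.
have uC n k : `|u n - u k| <= (n.+1%:R^-1 + k.+1%:R^-1 : R)%:C.
  set x := u n - u k.
  have [->|x0] := eqVneq x 0; first by rewrite normr0 ler0c addr_ge0 ?invr_ge0.
  rewrite -(ler_pM2r (_ : 0 < `|x|)) ?normr_gt0// -expr2 -inner_normE {2}/x.
  rewrite linearBr /= rmorphD mulrDl.
  apply: le_trans (lerD (fu n x) (fu k x)).
  rewrite -[X in _ <= X + _]normrN; apply: le_trans (ler_normD _ _).
  rewrite opprB addrA subrK.
  have -> : '[x, u n] - '[x, u k] = `|x| ^+ 2 by rewrite -inner_normE linearBr.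
  by rewrite real_ler_norm// rpredX// normr_real.
have /cauchy_cvgP /cvg_ex[/= y uy] : cauchy (u @ \oo).
  apply/cauchy_exP => e e0.
  have eE : (complex.Re e)%:C = e by rewrite RRe_real// ger0_real// ltW.
  have e20 : 0 < complex.Re e / 2 by rewrite divr_gt0// -ltcR eE.
  have [k] := ltr_add_invr e20; rewrite add0r => ke.
  exists (u k), k => // n /= kn; rewrite -ball_normE /ball_ /=.
  apply: le_lt_trans (uC k n) _; rewrite -eE ltcR.
  rewrite [ltRHS]splitr ltrD//; apply: le_lt_trans ke.
  by rewrite lef_pV2 ?posrE// ler_nat.
exists y => x.
have [->|x0] := eqVneq x 0.
  by have := f_linear (-1) 0 0; rewrite scaler0 addr0 mulN1r addNr linear0l.
have nx : 0 < `|x| by rewrite normr_gt0.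
apply/eqP; rewrite -subr_eq0 -normr_le0; apply/ler_addgt0Pr => e e0.
rewrite add0r; pose e' := complex.Re (e / `|x| / 2).
have e'E : e'%:C = e / `|x| / 2.
  by rewrite RRe_real// ger0_real// !divr_ge0// ltW.
have e'0 : 0 < e' by rewrite -ltcR e'E !divr_gt0.
near \oo => n.
have -> : e = (e'%:C + e'%:C) * `|x|.
  by rewrite e'E -splitr divfK// gt_eqF.
rewrite -(subrK '[x, u n] (f x)) -addrA -linearBr/= mulrDl.
apply: le_trans (ler_normD _ _) _; apply: lerD.
  apply: le_trans (fu n x) _; rewrite ler_wpM2r// lecR ltW//.
  near: n; have [k] := ltr_add_invr e'0; rewrite add0r => ke.
  exists k => // n /= kn; apply: le_lt_trans ke.
  by rewrite lef_pV2 ?posrE// ler_nat.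
rewrite (le_trans (CauchySchwarz _ _))// mulrC ler_wpM2r// distrC ltW//.
near: n; have /cvgrPdist_lt := uy; apply; by rewrite ltcR.
Unshelve. all: by end_near. Qed.
End Riesz.

Section Adjoint.
Context {R : realType} {H : hilbertType R}.
Local Notation "''[' x , y ]" := (inner x y).
Implicit Types (S T : bop H) (x y : H).

Lemma bop_bounded T : exists2 M : R[i], 0 < M & forall x, `|T x| <= M * `|x|.
Proof.
have /linear_boundedP : bounded_near T (nbhs (0 : H)).
  by apply/linear_bounded_continuous; exact: bop_continuous.
by move=> /pinfty_ex_gt0[M M0 TM]; exists M.
Qed.

Lemma adjoint_exists T : exists S, forall x y, '[T x, y] = '[x, S y].
Proof.
have [M M0 TM] := bop_bounded T.
have /choice[g Tg] y : exists u, forall x, '[T x, y] = '[x, u].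
  apply: riesz => [a x z|]; first by rewrite linearP linearPl.
  exists (M * `|y|) => x; apply: le_trans (CauchySchwarz _ _) _.
  by rewrite mulrAC ler_wpM2r.
have innerI x y : (forall z, '[z, x] = '[z, y]) -> x = y.
  move=> xy; apply/eqP; rewrite -subr_eq0 -normr_eq0 -sqrf_eq0 -inner_normE.
  by rewrite linearBr /= xy subrr.
have gl : linear g.
  move=> a x y; apply: innerI => z.
  by rewrite -Tg !linearPr /= !Tg.
pose G : {linear H -> H} := HB.pack g (GRing.isLinear.Build R[i] H H *:%R g gl).
have gb x : `|g x| <= M * `|x|.
  have [->|gx0] := eqVneq (g x) 0; first by rewrite normr0 mulr_ge0// ltW.
  rewrite -(ler_pM2r (_ : 0 < `|g x|)) ?normr_gt0// -expr2 -inner_normE -Tg.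
  apply: le_trans (real_ler_norm _) (le_trans (CauchySchwarz _ _) _).
    by rewrite Tg inner_normE rpredX ?normr_real.
  by rewrite mulrAC ler_wpM2r.
have gc : continuous g.
  apply: (bounded_linear_continuous (f := G)); apply/linear_boundedP.
  near=> r => x; apply: le_trans (gb x) _; rewrite ler_wpM2r//.
  by near: r; apply: nbhs_pinfty_ge; rewrite gtr0_real.
have gP : g \in @bounded_op R H by apply/asboolP.
by exists (BOp gP) => x y; exact: Tg.
Unshelve. all: by end_near. Qed.

Definition adj T : bop H := projT1 (cid (adjoint_exists T)).

Lemma adjP T x y : '[T x, y] = '[x, adj T y].
Proof. exact: projT2 (cid (adjoint_exists T)) x y. Qed.
End Adjoint.

Section VonNeumannAlgebras.
Context {R : realType} {H : hilbertType R}.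
Local Notation "''[' x , y ]" := (inner x y).
Implicit Types (M : set (bop H)) (S T : bop H) (tau : bop H -> R[i]).

Definition self_adjoint T : Prop := adj T = T.

Definition wot_closure M : set (bop H) :=
  [set T | forall (m : nat) (x y : 'I_m -> H) (e : R[i]), 0 < e ->
    exists2 S, M S & forall i, `|'[(S - T) (x i), y i]| < e].

Record von_neumann_algebra M : Prop := VonNeumannAlgebra {
  vna_one : M 1;
  vna_linear : forall (a : R[i]) S T, M S -> M T -> M (a *: S + T);
  vna_mul : forall S T, M S -> M T -> M (S * T);
  vna_adj : forall T, M T -> M (adj T);
  vna_wot_closed : wot_closure M `<=` M }.

Definition vna_generated_by (I : Type) (X : I -> bop H) M : Prop :=
  [/\ von_neumann_algebra M, forall i, M (X i) &
    forall M', von_neumann_algebra M' -> (forall i, M' (X i)) -> M `<=` M'].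

(* Functionals on M are total functions on B(H) whose values outside of M are
   irrelevant. *)
Record state_on M tau : Prop := StateOn {
  state_linear : forall (a : R[i]) S T, M S -> M T ->
    tau (a *: S + T) = a * tau S + tau T;
  state_ge0 : forall T, M T -> 0 <= tau (adj T * T);
  state_one : tau 1 = 1 }.

Definition tracial_on M tau : Prop :=
  forall S T, M S -> M T -> tau (S * T) = tau (T * S).

Definition faithful_on M tau : Prop :=
  forall T, M T -> tau (adj T * T) = 0 -> T = 0.

Definition square_summable (x : nat -> H) : Prop :=
  cvgn (series (fun n => `|x n| ^+ 2)).

Definition ultraweak_functional (x y : nat -> H) T : R[i] :=
  limn (series (fun n => '[T (x n), y n])).

(* Normality is continuity on M for the ultraweak topology, whose basic
   neighbourhoods are given by finitely many ultraweak functionals. *)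
Definition normal_on M tau : Prop :=
  forall T (e : R[i]), M T -> 0 < e ->
    exists (m : nat) (x y : 'I_m -> nat -> H) (d : R[i]),
      [/\ 0 < d,
          forall i, square_summable (x i) /\ square_summable (y i) &
          forall S, M S ->
            (forall i, `|ultraweak_functional (x i) (y i) (S - T)| < d) ->
            `|tau S - tau T| < e].

Record normal_faithful_tracial_state M tau : Prop := NormalFaithfulTracialState {
  nft_state : state_on M tau;
  nft_normal : normal_on M tau;
  nft_faithful : faithful_on M tau;
  nft_tracial : tracial_on M tau }.

(* The tensor product of the n x n complex matrices with a subalgebra M of B(H)
   is the algebra of n x n matrices over M; the elementary tensor of a and T has
   (r, s)-entry a_rs T. *)
Definition tensmx n (a : 'M[R[i]]_n) T : 'M[bop H]_n :=
  \matrix_(r, s) (a r s *: T).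

(* tr_n (x) tau, where tr_n is the normalized trace. *)
Definition tens_trace n tau (A : 'M[bop H]_n) : R[i] :=
  n%:R^-1 * \sum_(r < n) tau (A r r).

End VonNeumannAlgebras.

(* The distribution of a self-adjoint element is the compactly supported
   probability measure having its moments, so that two self-adjoint elements
   have the same distribution when their moments coincide. *)
Definition same_distribution (C : Type) (A B : pzRingType)
    (sigma : A -> C) (rho : B -> C) (S : A) (T : B) : Prop :=
  forall p : nat, (1 <= p)%N -> sigma (S ^+ p) = rho (T ^+ p).

Record star_isomorphism (R : realType) (H K : hilbertType R)
    (M : set (bop H)) (N : set (bop K)) (phi : bop H -> bop K) : Prop :=
  StarIsomorphism {
    siso_bij : set_bij M N phi;
    siso_linear : forall (a : R[i]) S T, M S -> M T ->
      phi (a *: S + T) = a *: phi S + phi T;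
    siso_mul : forall S T, M S -> M T -> phi (S * T) = phi S * phi T;
    siso_one : phi 1 = 1;
    siso_adj : forall T, M T -> phi (adj T) = adj (phi T) }.

(* Main.v *)
From HB Require Import structures.
Require Import Defs.
From mathcomp Require Import all_boot all_order all_algebra complex.
From mathcomp Require Import ring lra.
From mathcomp Require Import boolp classical_sets functions reals topology normedtype sequences.
Set Implicit Arguments. Unset Strict Implicit. Unset Printing Implicit Defensive.
Import Order.TTheory GRing.Theory Num.Theory numFieldNormedType.Exports.
Local Open Scope classical_set_scope.
Local Open Scope ring_scope.
Local Open Scope complex_scope.

(** The theorem has two halves.

    Equal distributions give equal moments.  Put D(w) = tau(X_w) - chi(Y_w) for a word
    w.  The p-th moment of the sum of the a_i (x) X_i is, up to the factor 1/n, the sum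
    over words w of length p of Tr(a_w) tau(X_w), so the hypothesis says that the
    polynomial F(a) = sum_w Tr(a_w) D(w) vanishes on tuples of hermitian matrices with
    spectrum in [c, d].  Such tuples contain a neighbourhood of a scalar tuple among the
    hermitian ones, and F is a homogeneous polynomial, hence F vanishes on all hermitian
    tuples; as every matrix is x + i y with x, y hermitian and F(x + u y) is polynomial
    in u, it vanishes on all tuples (word_trace_all).  Evaluated at the adjacency
    matrices of an oriented cycle of length p whose edges are labelled by the letters
    of w, F is the sum of D over the p rotations of w, which is p D(w) because traces
    are cyclic (word_trace_eq0).  So D(w) = 0.

    Equal moments give an isomorphism (isomorphism_of_moments).  Its graph consists of
    the pairs (S, T) that are limits in the 2-norms |S| = tau(S^* S)^(1/2) of a pair
    (p(X), p(Y)) of values of the same noncommutative polynomials, with the operator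
    norms on both sides staying bounded.  The 2-norm of a polynomial is a moment, so the
    two 2-norms agree on the graph, which is closed under the *-algebra operations and,
    the traces being faithful, is the graph of an injective map.  By symmetry only
    totality has to be shown, and it suffices to treat a small self-adjoint T in M.

    Totality is a Kaplansky density argument run on both sides at once
    (simultaneous_kaplansky).  The weak closure of the polynomials in X is a von Neumann
    algebra, so it contains M, and by convexity self-adjoint elements of M are strong
    limits of self-adjoint polynomials.  Write T = f(x) with f(t) = t / (1 + t^2).  Then
    f(p(X)) tends strongly to T when p(X) tends strongly to x, while f(p(X)) and f(p(Y))
    have norm at most 1.  On bounded sets a normal trace only sees finitely many matrix
    coefficients up to a small error, so the convergence holds in the 2-norm.  On the
    other side one gets a bounded 2-norm Cauchy sequence, which converges in N by weak
    compactness of balls (norm2_complete). *)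

(** * Real-valued norms *)

Section RealNorm.
Context {R : realType}.

(** Norms take values in R[i], whose order is only partial; their real parts live in a
    totally ordered field. *)
Definition nrm (V : normedZmodType R[i]) (v : V) : R := complex.Re `|v|.

Section Any.
Context {V : normedZmodType R[i]}.
Implicit Types u v : V.

Lemma nrmE v : `|v| = (nrm v)%:C.
Proof. by rewrite RRe_real// normr_real. Qed.

Lemma nrm_ge0 v : 0 <= nrm v.
Proof. by rewrite -ler0c -nrmE. Qed.

Lemma nrm0 : nrm (0 : V) = 0.
Proof. by rewrite /nrm normr0. Qed.

Lemma nrm_eq0 v : nrm v = 0 -> v = 0.
Proof. by move=> v0; apply/normr0_eq0; rewrite nrmE v0. Qed.

Lemma nrmN v : nrm (- v) = nrm v.
Proof. by rewrite /nrm normrN. Qed.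

Lemma nrm_distC u v : nrm (u - v) = nrm (v - u).
Proof. by rewrite /nrm distrC. Qed.

Lemma nrm_triangle u v : nrm (u + v) <= nrm u + nrm v.
Proof. by rewrite -lecR rmorphD/= -!nrmE ler_normD. Qed.

Lemma nrm_dist w u v : nrm (u - v) <= nrm (u - w) + nrm (w - v).
Proof. by rewrite -{1}(subrK w u) -addrA nrm_triangle. Qed.

Lemma nrm_sum (I : Type) (r : seq I) (P : pred I) (F : I -> V) :
  nrm (\sum_(i <- r | P i) F i) <= \sum_(i <- r | P i) nrm (F i).
Proof.
elim/big_rec2: _ => [|i x y _ xy]; first by rewrite nrm0.
by apply: le_trans (nrm_triangle _ _) _; rewrite lerD2l.
Qed.

End Any.

Lemma nrmM (a b : R[i]) : nrm (a * b) = nrm a * nrm b.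
Proof. by apply: complexI; rewrite rmorphM /= -!nrmE normrM. Qed.

Lemma nrmZ (V : normedModType R[i]) a (v : V) : nrm (a *: v) = nrm a * nrm v.
Proof. by apply: complexI; rewrite rmorphM /= -!nrmE normrZ. Qed.

Lemma nrm_real (r : R) : nrm r%:C = `|r|.
Proof.
rewrite /nrm normc_def /= expr0n addr0; exact: sqrtr_sqr.
Qed.

Lemma nrm_i : nrm ('i : R[i]) = 1.
Proof. by rewrite /nrm normc_def /= expr0n add0r expr1n sqrtr1. Qed.

Lemma nrm_conj (a : R[i]) : nrm (a^*)%R = nrm a.
Proof. by rewrite /nrm norm_conjC. Qed.

Lemma Re_conj (a : R[i]) : complex.Re (a^*)%R = complex.Re a.
Proof. by case: a. Qed.

Lemma ReD (a b : R[i]) : complex.Re (a + b) = complex.Re a + complex.Re b.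
Proof. by case: a; case: b. Qed.

Lemma ReN (a : R[i]) : complex.Re (- a) = - complex.Re a.
Proof. by case: a. Qed.

Lemma ReZ (r : R) (a : R[i]) : complex.Re (r%:C * a) = r * complex.Re a.
Proof. by case: a => x y /=; rewrite mul0r subr0. Qed.

Lemma normRe_le (a : R[i]) : `|complex.Re a| <= nrm a.
Proof. by rewrite -lecR -nrmE normc_ge_Re. Qed.

Lemma normIm_le (a : R[i]) : `|complex.Im a| <= nrm a.
Proof.
have -> : complex.Im a = complex.Re (a * - 'i).
  by case: a => x y /=; rewrite oppr0 mulr0 mulrN1 sub0r opprK.
by apply: le_trans (normRe_le _) _; rewrite nrmM nrmN nrm_i mulr1.
Qed.

Lemma nrm_le_ReIm (a : R[i]) : nrm a <= `|complex.Re a| + `|complex.Im a|.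
Proof.
rewrite {1}(complexE a); apply: le_trans (nrm_triangle _ _) _.
by rewrite nrmM nrm_i mul1r !nrm_real.
Qed.

Lemma conj_real (t : R) : ((t%:C)^*)%R = t%:C :> R[i].
Proof. by apply: conj_Creal; apply/complex_realP; exists t. Qed.

Lemma ltc_real (e : R[i]) : 0 < e -> exists2 r : R, 0 < r & e = r%:C.
Proof.
move=> e0; exists (complex.Re e); first by rewrite -ltcR RRe_real ?gtr0_real.
by rewrite RRe_real// gtr0_real.
Qed.

(** Evaluating at t = - b / c would prove this if c were nonzero; a small d added to c
    treats all cases at once. *)
Lemma discriminant_le (a b c : R) : 0 <= a -> 0 <= c ->
  (forall t, 0 <= a + 2 * t * b + t ^+ 2 * c) -> b ^+ 2 <= a * c.
Proof.
move=> a0 c0 abc; apply/ler_addgt0Pr => e e0.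
pose d := e / (a + 1); have a1 : 0 < a + 1 by rewrite ltr_wpDl.
have d0 : 0 < d by rewrite divr_gt0.
have ad : a * d <= e.
  have : d * (a + 1) = e by rewrite divfK// gt_eqF.
  nra.
have cd : 0 < c + d by rewrite ltr_wpDl.
have := abc (- b / (c + d)).
have -> : a + 2 * (- b / (c + d)) * b + (- b / (c + d)) ^+ 2 * c
    = ((a * (c + d) - b ^+ 2) * (c + d) - b ^+ 2 * d) / (c + d) ^+ 2.
  by field; rewrite gt_eqF.
rewrite pmulr_lge0 ?invr_gt0 ?exprn_gt0// subr_ge0 => h.
have : 0 <= a * (c + d) - b ^+ 2.
  by rewrite -(pmulr_lge0 _ cd); apply: le_trans h; rewrite mulr_ge0 ?sqr_ge0// ltW.
nra.
Qed.

Lemma real_of_ge0 (a : R[i]) : 0 <= a -> a = (complex.Re a)%:C.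
Proof. by move=> a0; rewrite RRe_real// ger0_real. Qed.

End RealNorm.

(** * Bounded operators on a Hilbert space *)

Section InnerProduct.
Context {R : realType} {H : hilbertType R}.
Implicit Types x y z : H.

Lemma innerxx x : inner x x = ((nrm x) ^+ 2)%:C.
Proof. by rewrite inner_normE nrmE rmorphXn. Qed.

Lemma nrm_inner x y : nrm (inner x y) <= nrm x * nrm y.
Proof. by rewrite -lecR rmorphM /= -!nrmE Defs.CauchySchwarz. Qed.

Lemma innerC x y : inner x y = ((inner y x)^*)%R.
Proof. by rewrite (hermC inner x y) /= expr0 mul1r. Qed.

Lemma innerDl x y z : inner (x + y) z = inner x z + inner y z.
Proof. exact: linearDl. Qed.
Lemma innerBl x y z : inner (x - y) z = inner x z - inner y z.
Proof. exact: linearBl. Qed.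
Lemma innerDr x y z : inner x (y + z) = inner x y + inner x z.
Proof. by rewrite linearDr. Qed.
Lemma innerBr x y z : inner x (y - z) = inner x y - inner x z.
Proof. by rewrite linearBr. Qed.
Lemma innerZl a x y : inner (a *: x) y = a * inner x y.
Proof. by rewrite linearZl_LR. Qed.
Lemma innerZr a x y : inner x (a *: y) = (a^*)%R * inner x y.
Proof. by rewrite linearZr_LR. Qed.
Lemma inner0l x : inner 0 x = 0.
Proof. exact: linear0l. Qed.

Lemma inner_ext x y : (forall z, inner z x = inner z y) -> x = y.
Proof.
move=> xy; apply/eqP; rewrite -subr_eq0; apply/eqP/nrm_eq0/eqP.
rewrite -sqrf_eq0; apply/eqP/complexI.
by rewrite -innerxx innerBr xy subrr.
Qed.

End InnerProduct.

Section Operators.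
Context {R : realType} {H : hilbertType R}.
Implicit Types (S T : bop H) (x y : H) (r s : R).

Lemma bopDE S T x : (S + T) x = S x + T x. Proof. by []. Qed.
Lemma bopNE S x : (- S) x = - S x. Proof. by []. Qed.
Lemma bopBE S T x : (S - T) x = S x - T x. Proof. by []. Qed.
Lemma bopZE (a : R[i]) S x : (a *: S) x = a *: S x. Proof. by []. Qed.
Lemma bopME S T x : (S * T) x = S (T x). Proof. by []. Qed.
Lemma bop1E x : (1 : bop H) x = x. Proof. by []. Qed.
Lemma bop0E x : (0 : bop H) x = 0. Proof. by []. Qed.
Definition bopE := (bopBE, bopDE, bopNE, bopZE, bopME, bop1E, bop0E).

Lemma bopB S x y : S (x - y) = S x - S y. Proof. exact: linearB. Qed.
Lemma bopZ S (a : R[i]) x : S (a *: x) = a *: S x. Proof. exact: linearZ. Qed.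

Lemma scale_mull (a : R[i]) S T : (a *: S) * T = a *: (S * T).
Proof. exact: bopP. Qed.
Lemma scale_mulr (a : R[i]) S T : S * (a *: T) = a *: (S * T).
Proof. by apply: bopP => x; rewrite !bopE bopZ. Qed.

Lemma adjPl T x y : inner (adj T x) y = inner x (T y).
Proof. by rewrite innerC -adjP -innerC. Qed.

Lemma adj_unique S T : (forall x y, inner (T x) y = inner x (S y)) -> adj T = S.
Proof. by move=> TS; apply: bopP => y; apply: inner_ext => x; rewrite -adjP. Qed.

Lemma adjK T : adj (adj T) = T.
Proof. by apply: adj_unique => x y; rewrite adjPl. Qed.
Lemma adj1 : adj (1 : bop H) = 1.
Proof. exact: adj_unique. Qed.
Lemma adjM S T : adj (S * T) = adj T * adj S.
Proof. by apply: adj_unique => x y; rewrite !bopE !adjP. Qed.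
Lemma adjD S T : adj (S + T) = adj S + adj T.
Proof. by apply: adj_unique => x y; rewrite !bopE innerDl innerDr !adjP. Qed.
Lemma adjZ (a : R[i]) T : adj (a *: T) = (a^*)%R *: adj T.
Proof. by apply: adj_unique => x y; rewrite !bopE innerZl innerZr conjCK adjP. Qed.
Lemma adjN T : adj (- T) = - adj T.
Proof. by rewrite -scaleN1r adjZ rmorphN rmorph1 scaleN1r. Qed.
Lemma adjB S T : adj (S - T) = adj S - adj T.
Proof. by rewrite adjD adjN. Qed.
Lemma adj0 : adj (0 : bop H) = 0.
Proof. by have := adjB 1 1; rewrite !subrr. Qed.
Lemma adj_lin (a : R[i]) S T : adj (a *: S + T) = (a^*)%R *: adj S + adj T.
Proof. by rewrite adjD adjZ. Qed.

Definition bounded_by r T := forall x, nrm (T x) <= r * nrm x.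

Lemma bounded_by_le r s T : r <= s -> bounded_by r T -> bounded_by s T.
Proof. by move=> rs Tr x; apply: le_trans (Tr x) _; rewrite ler_wpM2r// nrm_ge0. Qed.

Lemma bounded_by_ex T : exists2 r, 0 < r & bounded_by r T.
Proof.
have [M /ltc_real[r r0 ->] TM] := bop_bounded T; exists r => // x.
by have := TM x; rewrite !nrmE -rmorphM /= lecR.
Qed.

Lemma bounded_byD r s S T : bounded_by r S -> bounded_by s T -> bounded_by (r + s) (S + T).
Proof.
move=> Sr Ts x; apply: le_trans (nrm_triangle _ _) _.
by rewrite mulrDl; exact: lerD (Sr x) (Ts x).
Qed.
Lemma bounded_byN r T : bounded_by r T -> bounded_by r (- T).
Proof. by move=> Tr x; rewrite bopE nrmN. Qed.
Lemma bounded_byB r s S T : bounded_by r S -> bounded_by s T -> bounded_by (r + s) (S - T).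
Proof. by move=> Sr Ts; apply: bounded_byD => //; exact: bounded_byN. Qed.
Lemma bounded_byZ r (a : R[i]) T : bounded_by r T -> bounded_by (nrm a * r) (a *: T).
Proof. by move=> Tr x; rewrite bopE nrmZ -mulrA; apply: ler_wpM2l (Tr x); exact: nrm_ge0. Qed.
Lemma bounded_byM r s S T : 0 <= r ->
  bounded_by r S -> bounded_by s T -> bounded_by (r * s) (S * T).
Proof.
move=> r0 Sr Ts x; rewrite bopE -mulrA; apply: le_trans (Sr _) _.
exact: ler_wpM2l (Ts x).
Qed.
Lemma bounded_by1 : bounded_by 1 1.
Proof. by move=> x; rewrite mul1r. Qed.
Lemma bounded_by0 r : 0 <= r -> bounded_by r 0.
Proof. by move=> r0 x; rewrite bopE nrm0 mulr_ge0 ?nrm_ge0. Qed.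

Lemma le_of_sq_le (a b : R) : 0 <= b -> a * a <= b * a -> a <= b.
Proof. by move=> b0 ab; case: (lerP a b) => // ba; nra. Qed.

Lemma bounded_by_adj r T : 0 <= r -> bounded_by r T -> bounded_by r (adj T).
Proof.
move=> r0 Tr x; have rx0 : 0 <= r * nrm x by rewrite mulr_ge0 ?nrm_ge0.
apply: le_of_sq_le => //; rewrite -expr2 -[_ ^+ 2]ger0_norm ?sqr_ge0//.
rewrite -nrm_real -innerxx -adjP.
apply: le_trans (nrm_inner _ _) _.
apply: le_trans (ler_wpM2r (nrm_ge0 _) (Tr _)) _.
by rewrite mulrAC.
Qed.

(** Bounded operators are given as continuous linear maps, whereas the constructions
    below produce linear maps with an explicit bound. *)
Lemma bop_of_bounded (g : H -> H) r : linear g ->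
  (forall x, nrm (g x) <= r * nrm x) -> exists S, S =1 g.
Proof.
move=> gl gr.
pose G : {linear H -> H} := HB.pack g (GRing.isLinear.Build R[i] H H *:%R g gl).
have gc : continuous g.
  apply: (bounded_linear_continuous (f := G)); apply/linear_boundedP.
  near=> M => x; apply: le_trans (_ : r%:C * `|x| <= _).
    by rewrite !nrmE -rmorphM /= lecR gr.
  rewrite ler_wpM2r//; near: M; apply: nbhs_pinfty_ge.
  by apply/complex_realP; exists r.
have gP : g \in @bounded_op R H by apply/asboolP.
by exists (BOp gP).
Unshelve. all: by end_near. Qed.

Lemma hilbert_complete (u : nat -> H) :
  (forall e : R, 0 < e -> exists n, forall l m, (n <= l)%N -> (n <= m)%N ->
    nrm (u l - u m) < e) ->
  exists z, forall e : R, 0 < e -> exists n, forall l, (n <= l)%N -> nrm (z - u l) < e.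
Proof.
move=> uC.
have /cauchy_cvgP /cvg_ex[/= z uz] : cauchy (u @ \oo).
  apply/cauchy_exP => _ /ltc_real[e e0 ->].
  have [n un] := uC e e0; exists (u n), n => // l /= nl.
  by rewrite -ball_normE /ball_ /= nrmE ltcR un.
exists z => e e0; have /cvgrPdist_lt := uz.
move=> /(_ e%:C); rewrite ltcR => /(_ e0)[n _ un]; exists n => l nl.
by have := un l nl; rewrite nrmE ltcR.
Qed.

End Operators.

(** * Norm limits of operators *)

Section NormLimits.
Context {R : realType} {H : hilbertType R}.
Implicit Types (S T : bop H) (x y : H) (r s : R) (u : nat -> bop H).

Definition op_cvg u S := forall e : R, 0 < e ->
  exists n, forall l, (n <= l)%N -> bounded_by e (S - u l).

Lemma bounded_by_eq0 S : (forall e : R, 0 < e -> bounded_by e S) -> S = 0.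
Proof.
move=> S0; apply: bopP => x; apply: nrm_eq0; apply/eqP.
rewrite eq_le nrm_ge0 andbT; apply/ler_addgt0Pr => e e0; rewrite add0r.
have x1 : 0 < nrm x + 1 by rewrite ltr_wpDl ?nrm_ge0.
apply: le_trans (S0 (e / (nrm x + 1)) _ x) _; first by rewrite divr_gt0.
by rewrite mulrAC ler_pdivrMr// ler_pM2l// lerDl.
Qed.

Lemma op_cvg_eq u S T :
  op_cvg u S -> (forall e : R, 0 < e -> exists n, forall l, (n <= l)%N ->
    bounded_by e (T - u l)) -> S = T.
Proof.
move=> uS uT; apply/eqP; rewrite -subr_eq0; apply/eqP/bounded_by_eq0 => e e0.
have e2 : 0 < e / 2 by rewrite divr_gt0.
have [n un] := uS _ e2; have [m um] := uT _ e2.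
rewrite (_ : S - T = (S - u (maxn n m)) - (T - u (maxn n m))); last first.
  by rewrite opprB addrA subrK.
rewrite (splitr e); apply: bounded_byB; [apply: un|apply: um].
  exact: leq_maxl.
exact: leq_maxr.
Qed.

(** The pointwise limit of a norm Cauchy sequence is linear and bounded, and the
    convergence is uniform because the Cauchy estimate passes to the limit. *)
Lemma norm_cauchy_cvg u :
  (forall e : R, 0 < e -> exists n, forall l m, (n <= l)%N -> (n <= m)%N ->
    bounded_by e (u l - u m)) -> exists S, op_cvg u S.
Proof.
move=> uC.
have /choice[z uz] : forall x, exists z, forall e : R, 0 < e -> exists n,
    forall l, (n <= l)%N -> nrm (z - u l x) < e.
  move=> x; apply: hilbert_complete => e e0.
  have x1 : 0 < nrm x + 1 by rewrite ltr_wpDl ?nrm_ge0.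
  have [|n un] := uC (e / (nrm x + 1)); first by rewrite divr_gt0.
  exists n => l m nl nm; apply: le_lt_trans (un l m nl nm x) _.
  by rewrite mulrAC ltr_pdivrMr// ltr_pM2l// ltrDl.
have zE e : 0 < e -> exists n, forall l, (n <= l)%N -> forall x,
    nrm (z x - u l x) <= e * nrm x.
  move=> e0; have [n un] := uC e e0; exists n => l nl x.
  apply/ler_addgt0Pr => d d0; have [m um] := uz x d d0.
  apply: le_trans (nrm_dist (u (maxn n m) x) _ _) _; rewrite addrC.
  apply: lerD; first by apply: un => //; exact: leq_maxl.
  by apply/ltW/um; exact: leq_maxr.
have zl : linear z.
  move=> a x y; apply/eqP; rewrite -subr_eq0; apply/eqP/nrm_eq0/eqP.
  rewrite eq_le nrm_ge0 andbT; apply/ler_addgt0Pr => e e0; rewrite add0r.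
  pose s := nrm (a *: x + y) + nrm a * nrm x + nrm y + 1.
  have s0 : 0 < s by rewrite ltr_wpDl// !addr_ge0 ?mulr_ge0 ?nrm_ge0.
  have [|n un] := zE (e / s); first by rewrite divr_gt0.
  have {}un v := un n (leqnn n) v.
  rewrite (_ : z (a *: x + y) - _ = z (a *: x + y) - u n (a *: x + y)
     - (a *: (z x - u n x) + (z y - u n y))); last first.
    by rewrite bop_linear scalerBr addrACA -opprD opprB addrA subrK.
  apply: le_trans (nrm_triangle _ _) _; rewrite nrmN.
  apply: le_trans (lerD (un _) (nrm_triangle _ _)) _; rewrite nrmZ.
  apply: (@le_trans _ _ (e / s * nrm (a *: x + y)
     + (nrm a * (e / s * nrm x) + e / s * nrm y))).
    rewrite lerD2l; apply: lerD (un y); apply: ler_wpM2l (un x); exact: nrm_ge0.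
  rewrite mulrCA -!mulrDr mulrAC ler_pdivrMr// ler_pM2l// /s !addrA.
  by rewrite lerDl.
have [n un] := zE 1 ltr01; have [r r0 ur] := bounded_by_ex (u n).
have [x|S Sz] := @bop_of_bounded _ _ z (1 + r) zl.
  rewrite -{1}(subrK (u n x) (z x)); apply: le_trans (nrm_triangle _ _) _.
  by rewrite mulrDl; apply: lerD; [exact: un|exact: ur].
exists S => e /zE[m um]; exists m => l ml x.
by rewrite bopE Sz; exact: um.
Qed.

Lemma pow_small (t e : R) : 0 <= t -> t < 1 -> 0 < e ->
  exists n, forall l, (n <= l)%N -> t ^+ l < e.
Proof.
move=> t0 t1 e0; have /cvgrPdist_lt/(_ _ e0)[n _ tn] : t ^+ n @[n --> \oo] --> 0.
  by apply: cvg_expr; rewrite ger0_norm.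
exists n => l /tn /=; rewrite sub0r normrN ger0_norm//; exact: exprn_ge0.
Qed.

(** The increments telescope: u_(n+k) - u_n is bounded by C (t^n - t^(n+k)) / (1 - t). *)
Lemma geometric_cvg u (C t : R) : 0 <= C -> 0 <= t -> t < 1 ->
  (forall l, bounded_by (C * t ^+ l) (u l.+1 - u l)) -> exists S, op_cvg u S.
Proof.
move=> C0 t0 t1 ut; apply: norm_cauchy_cvg => e e0.
have ut' n k : bounded_by (C * t ^+ n * (1 - t)^-1) (u (n + k)%N - u n).
  apply: (@bounded_by_le _ _ (C * (t ^+ n - t ^+ (n + k)) * (1 - t)^-1)).
    rewrite ler_wpM2r ?invr_ge0 ?subr_ge0 ?(ltW t1)// ler_wpM2l//.
    by rewrite gerBl exprn_ge0.
  elim: k => [|k IHk].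
    by rewrite addn0 !subrr mulr0 mul0r; exact: bounded_by0.
  have -> : u (n + k.+1)%N - u n = (u (n + k)%N - u n) + (u (n + k.+1)%N - u (n + k)%N).
    by rewrite [RHS]addrC addrA subrK.
  have -> : C * (t ^+ n - t ^+ (n + k.+1)) / (1 - t) =
      C * (t ^+ n - t ^+ (n + k)) / (1 - t) + C * t ^+ (n + k).
    have : 1 - t != 0 by rewrite subr_eq0 gt_eqF.
    by rewrite addnS exprS => ?; field.
  by apply: bounded_byD => //; rewrite addnS; exact: ut.
have [|n tn] := @pow_small t (e * (1 - t) / (2 * (C + 1))) t0 t1.
  by rewrite divr_gt0// mulr_gt0 ?subr_gt0// ltr_wpDl.
have nE : C * t ^+ n * (1 - t)^-1 <= e / 2.
  have C1 : 0 < 2 * (C + 1) by rewrite mulr_gt0// ltr_wpDl.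
  rewrite ler_pdivrMr ?subr_gt0//.
  have := ltW (tn n (leqnn n)); rewrite ler_pdivlMr//.
  have := exprn_ge0 n t0; set w := t ^+ n; nra.
exists n => l m nl nm.
rewrite (_ : u l - u m = (u l - u n) - (u m - u n)); last by rewrite opprB addrA subrK.
rewrite (splitr e); apply: bounded_byB; apply: bounded_by_le nE _.
  by rewrite -(subnKC nl).
by rewrite -(subnKC nm).
Qed.

Lemma op_cvg_adj u S : op_cvg u S -> op_cvg (fun l => adj (u l)) (adj S).
Proof.
move=> uS e e0; have [n un] := uS e e0; exists n => l nl.
by rewrite -adjB; apply: bounded_by_adj (ltW e0) (un l nl).
Qed.

Lemma op_cvg_self_adjoint u S :
  op_cvg u S -> (forall l, self_adjoint (u l)) -> self_adjoint S.
Proof.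
move=> uS u_sa; symmetry; apply: (op_cvg_eq uS) => e e0.
have [n un] := op_cvg_adj uS e0; exists n => l nl.
by rewrite -(u_sa l); exact: un.
Qed.

(** A norm limit is in particular a weak limit. *)
Lemma norm_closed (M : set (bop H)) u S :
  von_neumann_algebra M -> (forall l, M (u l)) -> op_cvg u S -> M S.
Proof.
move=> vM Mu uS; apply: (vna_wot_closed vM) => m x y _ /ltc_real[e e0 ->].
pose s := \sum_(i < m) nrm (x i) * nrm (y i) + 1.
have ge0 i : 0 <= nrm (x i) * nrm (y i) by rewrite mulr_ge0 ?nrm_ge0.
have s0 : 0 < s by rewrite ltr_wpDl// sumr_ge0.
have [|n un] := uS (e / s); first by rewrite divr_gt0.
exists (u n) => // i; rewrite nrmE ltcR.
apply: le_lt_trans (nrm_inner _ _) _.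
rewrite -opprB bopNE nrmN.
apply: le_lt_trans (ler_wpM2r (nrm_ge0 _) (un n (leqnn n) (x i))) _.
rewrite -(mulrA (e / s)) (mulrAC e) ltr_pdivrMr// ltr_pM2l// /s (bigD1 i)//=.
by rewrite -addrA ltrDl ltr_wpDl// sumr_ge0.
Qed.

End NormLimits.

Section VonNeumannAlgebraClosure.
Context {R : realType} {H : hilbertType R} {M : set (bop H)}.
Hypothesis vM : von_neumann_algebra M.
Implicit Types (S T : bop H) (a : R[i]).

Lemma vnaD S T : M S -> M T -> M (S + T).
Proof. by move=> MS MT; rewrite -(scale1r S); exact: vna_linear. Qed.
Lemma vna0 : M 0.
Proof. by rewrite -(addNr 1) -scaleN1r; apply: vna_linear => //; exact: vna_one. Qed.
Lemma vnaZ a S : M S -> M (a *: S).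
Proof. by move=> MS; rewrite -(addr0 (a *: S)); apply: vna_linear => //; exact: vna0. Qed.
Lemma vnaN S : M S -> M (- S).
Proof. by move=> MS; rewrite -scaleN1r; exact: vnaZ. Qed.
Lemma vnaB S T : M S -> M T -> M (S - T).
Proof. by move=> MS MT; apply: vnaD => //; exact: vnaN. Qed.
End VonNeumannAlgebraClosure.

(** * Functional calculus by iteration *)

Section FixedPoints.
Context {R : realType} {H : hilbertType R}.
Implicit Types (P Q S T y : bop H) (x : H) (r s : R).

Lemma bounded_by_half_unit P Q y : bounded_by (3/8) P -> bounded_by (1/2) Q ->
  bounded_by (1/2) y -> bounded_by (1/2) (P + Q * (y * y)).
Proof.
move=> P38 Q2 y2; rewrite [X in bounded_by X](_ : _ = 3/8 + 1/2 * (1/2 * (1/2))) ; last by lra.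
by apply: bounded_byD => //; do 2 (apply: bounded_byM => //; first by lra).
Qed.

(** The map y |-> P + Q y^2 sends the ball of radius 1/2 into itself, and it is a
    contraction there by y^2 - z^2 = y (y - z) + (y - z) z.  Its iterates from 0 are
    polynomials in P and Q, so they commute with P and Q and are self-adjoint. *)
Lemma quadratic_fixed_point (M : set (bop H)) P Q :
  von_neumann_algebra M -> M P -> M Q ->
  self_adjoint P -> self_adjoint Q -> P * Q = Q * P ->
  bounded_by (3/8) P -> bounded_by (1/2) Q ->
  exists y, [/\ M y, self_adjoint y & y = P + Q * (y * y)].
Proof.
move=> vM MP MQ P_sa Q_sa PQ P38 Q2.
pose F y := P + Q * (y * y); pose u l := iter l F (0 : bop H).
have uP l : [/\ M (u l), self_adjoint (u l), bounded_by (1/2) (u l),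
    P * u l = u l * P & Q * u l = u l * Q].
  elim: l => [|l [Mu u_sa u2 Pu Qu]]; rewrite /u/=; first split => //.
  - exact: vna0.
  - exact: adj0.
  - by apply: bounded_by0; lra.
  - by rewrite mulr0 mul0r.
  - by rewrite mulr0 mul0r.
  rewrite -/(u l); split.
  - by apply: vnaD => //; do 2 apply: vna_mul => //.
  - rewrite /self_adjoint /F adjD !adjM P_sa Q_sa u_sa.
    by rewrite -mulrA -Qu mulrA -Qu mulrA.
  - exact: bounded_by_half_unit.
  - rewrite /F mulrDr mulrDl; congr (_ + _).
    by rewrite mulrA PQ -!mulrA; congr (_ * _); rewrite mulrA Pu -mulrA Pu.
  - rewrite /F mulrDr mulrDl PQ; congr (_ + _).
    by rewrite -!mulrA -Qu; congr (_ * _); rewrite mulrA Qu -mulrA Qu.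
have [|||l|y uy] := @geometric_cvg _ _ u 1 (1/2); [lra|lra|lra| |].
  elim: l => [|l IHl].
    rewrite mul1r expr0 /u/= subr0; apply: (@bounded_by_le _ _ (1/2)); first by lra.
    by apply: bounded_by_half_unit => //; apply: bounded_by0; lra.
  have uS k : u k.+1 = F (u k) by [].
  rewrite {1}uS [in X in _ - X]uS /F opprD addrACA subrr add0r -mulrBr.
  set a := u l.+1 in IHl *; set b := u l in IHl *.
  have -> : a * a - b * b = a * (a - b) + (a - b) * b.
    by rewrite mulrBr mulrBl addrA subrK.
  have -> : 1 * (1/2) ^+ l.+1 = 1/2 * (1/2 * (1 * (1/2)^+l) + 1 * (1/2)^+l * (1/2)) :> R.
    by rewrite exprS; lra.
  have [_ _ a2 _ _] := uP l.+1; have [_ _ b2 _ _] := uP l.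
  have w0 : 0 <= 1 * (1/2)^+l :> R by rewrite mul1r exprn_ge0//; lra.
  by apply: bounded_byM => //; [lra|]; apply: bounded_byD; apply: bounded_byM => //; lra.
have My : M y by apply: norm_closed vM _ uy => l; have [] := uP l.
have y_sa : self_adjoint y by apply: op_cvg_self_adjoint uy _ => l; have [] := uP l.
exists y; split => //.
have uSy : op_cvg (fun l => u l.+1) y.
  by move=> e e0; have [n un] := uy e e0; exists n => l nl; apply: un; exact: leqW.
apply: (op_cvg_eq uSy) => e e0.
have [r r0 yr] := bounded_by_ex y.
have c0 : 0 < r + 1/2 by lra.
have [|n un] := uy (e / (r + 1/2)); first by rewrite divr_gt0.
exists n => l nl; rewrite /u iterS -/(u l) /F opprD addrACA subrr add0r -mulrBr.
have -> : y * y - u l * u l = y * (y - u l) + (y - u l) * u l.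
  by rewrite mulrBr mulrBl addrA subrK.
have e' : 0 <= e / (r + 1/2) by rewrite divr_ge0// ltW.
apply: (@bounded_by_le _ _ (1/2 * (r * (e / (r + 1/2)) + e / (r + 1/2) * (1/2)))).
  have -> : r * (e / (r + 1/2)) + e / (r + 1/2) * (1/2) = e.
    by field; rewrite gt_eqF//; lra.
  by lra.
have [_ _ u2 _ _] := uP l; have {}un := un l nl.
apply: bounded_byM => //; first by lra.
by apply: bounded_byD; apply: bounded_byM => //; exact: ltW.
Qed.

(** With y = A/2 + y^2/2 one has (1 - y)^2 = 1 - A; the bound 3/4 makes the fixed point
    lemma applicable. *)
Lemma sqrt_one_sub (M : set (bop H)) A : von_neumann_algebra M -> M A ->
  self_adjoint A -> bounded_by (3/4) A ->
  exists V, [/\ M V, self_adjoint V & V * V = 1 - A].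
Proof.
move=> vM MA A_sa A34.
pose h : R[i] := (1/2)%:C; have hJ : (h^*)%R = h by exact: conj_real.
have nh : nrm h = 1/2 by rewrite nrm_real ger0_norm//; lra.
have hh : h + h = 1 by rewrite -rmorphD; congr (_%:C); lra.
have [|||||||y [My y_sa yE]] := @quadratic_fixed_point M (h *: A) (h *: (1 : bop H)) vM.
- exact: vnaZ.
- by apply: vnaZ => //; exact: vna_one.
- by rewrite /self_adjoint adjZ A_sa hJ.
- by rewrite /self_adjoint adjZ adj1 hJ.
- by rewrite scale_mull scale_mulr mulr1 scale_mull mul1r.
- have -> : 3/8 = nrm h * (3/4) :> R by rewrite nh; lra.
  exact: bounded_byZ.
- have -> : 1/2 = nrm h * 1 :> R by rewrite nh; lra.
  by apply: bounded_byZ; exact: bounded_by1.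
exists (1 - y); split.
- by apply: vnaB => //; exact: vna_one.
- by rewrite /self_adjoint adjB adj1 y_sa.
rewrite mulrBr mulrBl mulr1 mul1r mulrBl mul1r.
have yE2 : y + y = A + y * y.
  by rewrite {1 2}yE addrACA -scalerDl hh scale1r scale_mull mul1r -scalerDl hh scale1r.
by rewrite opprB (addrC (y * y)) addrA -(addrA 1) -opprD yE2 opprD addrA subrK.
Qed.

(** The partial sums of the Neumann series of (1 + q^2)^-1, written around the
    centre c = 1 + r^2 so that it converges as soon as q is self-adjoint with
    norm at most r. *)
Fixpoint neumann (c : R) (q : bop H) l : bop H :=
  if l is l'.+1 then
    (c^-1)%:C *: (1 : bop H) + (1 - (c^-1)%:C *: (1 + q * q)) * neumann c q l'
  else 0.

Lemma one_add_sq_ge (q : bop H) z : self_adjoint q ->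
  complex.Re (inner ((1 + q * q) z) z) = nrm z ^+ 2 + nrm (q z) ^+ 2.
Proof. by move=> q_sa; rewrite !bopE innerDl (adjP q) q_sa !innerxx ReD. Qed.

(** The point is that k = (r^2 - q^2) / c has norm at most r^2 / c < 1.  Indeed
    |r^2 x - q^2 x|^2 = r^4 |x|^2 - 2 r^2 |q x|^2 + |q^2 x|^2 <= r^4 |x|^2. *)
Lemma neumann_cvg (q : bop H) r : 0 <= r -> self_adjoint q -> bounded_by r q ->
  exists h, [/\ op_cvg (neumann (1 + r ^+ 2) q) h,
    (1 + q * q) * h = 1 & h * (1 + q * q) = 1].
Proof.
move=> r0 q_sa qr; set c := 1 + r ^+ 2.
have c0 : 0 < c by rewrite ltr_pwDl// sqr_ge0.
pose k : bop H := 1 - (c^-1)%:C *: (1 + q * q).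
pose t := r ^+ 2 / c.
have t0 : 0 <= t by rewrite divr_ge0 ?sqr_ge0// ltW.
have t1 : t < 1 by rewrite ltr_pdivrMr// mul1r /c ltrDr.
have kE x : k x = (c^-1)%:C *: ((r ^+ 2)%:C *: x - q (q x)).
  rewrite /k !bopE scalerDr scalerBr scalerA opprD addrA; congr (_ - _).
  rewrite -{1}(scale1r x) -scalerBl; congr (_ *: _).
  rewrite (_ : 1 = (1 : R)%:C) // -rmorphB -rmorphM; congr (_%:C); rewrite /c; field.
  by rewrite gt_eqF.
have kt : bounded_by t k.
  move=> x; rewrite kE nrmZ nrm_real ger0_norm ?invr_ge0 ?(ltW c0)//.
  rewrite /t mulrAC mulrC ler_wpM2r ?invr_ge0 ?(ltW c0)//.
  have rx0 : 0 <= r ^+ 2 * nrm x by rewrite mulr_ge0 ?sqr_ge0 ?nrm_ge0.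
  rewrite -ler_sqr ?nnegrE ?nrm_ge0//.
  rewrite -lecR -innerxx innerBl !innerBr !innerZl !innerZr.
  have qqx : inner (q (q x)) x = (nrm (q x) ^+ 2)%:C.
    by rewrite (adjP q) q_sa innerxx.
  have xqq : inner x (q (q x)) = (nrm (q x) ^+ 2)%:C.
    by rewrite -(adjPl q) q_sa innerxx.
  rewrite qqx xqq !innerxx.
  rewrite conj_real -!rmorphM -!rmorphB lecR.
  have := qr (q x); have := nrm_ge0 (q (q x)); have := nrm_ge0 (q x).
  have r20 := sqr_ge0 r.
  set a := nrm (q x); set b := nrm (q (q x)) => a0 b0 ba.
  have : b ^+ 2 <= r ^+ 2 * a ^+ 2 by rewrite -exprMn ler_sqr ?nnegrE// mulr_ge0.
  by set r2 := r ^+ 2 in r20 *; set X := nrm x; nra.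
have kuE l : neumann c q l.+1 = (c^-1)%:C *: (1 : bop H) + k * neumann c q l by [].
have [|l|h uh] := @geometric_cvg _ _ (neumann c q) c^-1 t _ t0 t1.
- by rewrite invr_ge0 ltW.
- elim: l => [|l IHl].
    rewrite kuE /= mulr0 addr0 subr0 expr0.
    have -> : c^-1 * 1 = nrm ((c^-1)%:C) * 1 :> R.
      by rewrite nrm_real ger0_norm// invr_ge0 ltW.
    by apply: bounded_byZ; exact: bounded_by1.
  rewrite kuE [in X in _ - X]kuE opprD addrACA subrr add0r -mulrBr exprS mulrCA.
  exact: bounded_byM.
have hE : h = (c^-1)%:C *: (1 : bop H) + k * h.
  have uSh : op_cvg (fun l => neumann c q l.+1) h.
    by move=> e e0; have [n un] := uh e e0; exists n => l nl; apply: un; exact: leqW.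
  apply: (op_cvg_eq uSh) => e e0; have [n un] := uh e e0; exists n => l nl.
  rewrite kuE opprD addrACA subrr add0r -mulrBr.
  apply: (@bounded_by_le _ _ (t * e)); first by rewrite ler_piMl// ltW.
  by apply: bounded_byM => //; exact: un.
have qh1 : (1 + q * q) * h = 1.
  have : h - k * h = (c^-1)%:C *: (1 : bop H) by rewrite {1}hE addrK.
  rewrite /k mulrBl mul1r opprB addrC subrK scale_mull => /(congr1 (fun z => c%:C *: z)).
  by rewrite !scalerA -rmorphM mulfV ?gt_eqF// !scale1r.
exists h; split => //; apply/eqP; rewrite -subr_eq0; apply/eqP/bopP => x.
rewrite bop0E; apply: nrm_eq0; set z := (_ - _ : bop H) x.
have qz : (1 + q * q) z = 0.
  rewrite -[_ z]/(((1 + q * q) * (h * (1 + q * q) - 1)) x).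
  by rewrite mulrBr mulrA qh1 mul1r mulr1 subrr.
have := one_add_sq_ge z q_sa; rewrite qz inner0l /= => /esym.
have := sqr_ge0 (nrm (q z)); have := nrm_ge0 z; have := sqr_ge0 (nrm z).
by move=> ? ? ? /eqP; rewrite paddr_eq0// sqrf_eq0 => /andP[/eqP].
Qed.

(** Pairing (1 + q^2) h x = x with h x gives |h x|^2 + |q h x|^2 <= |x| |h x|, whatever
    the norm of q. *)
Lemma resolvent_bounded (q h : bop H) : self_adjoint q -> (1 + q * q) * h = 1 ->
  bounded_by 1 h /\ bounded_by 1 (q * h).
Proof.
move=> q_sa qh.
suff bnd x : nrm (h x) <= nrm x /\ nrm (q (h x)) <= nrm x.
  by split => x; rewrite mul1r; case: (bnd x).
have := one_add_sq_ge (h x) q_sa; rewrite -bopME qh bop1E => e.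
have : nrm (h x) ^+ 2 + nrm (q (h x)) ^+ 2 <= nrm x * nrm (h x).
  by rewrite -e; apply: le_trans (nrm_inner _ _); apply: le_trans (normRe_le _); exact: ler_norm.
have := nrm_ge0 x; have := nrm_ge0 (h x); have := nrm_ge0 (q (h x)).
set a := nrm (h x); set b := nrm (q _); set t := nrm x => b0 a0 t0 ab.
have at' : a <= t by apply: le_of_sq_le => //; nra.
split => //; rewrite -ler_sqr ?nnegrE//; nra.
Qed.

(** This is f(a) - f(b) for f(t) = t / (1 + t^2) and h_a = (1 + a^2)^-1.  On the right
    a - b is multiplied on the left by contractions, and on the right by operators that
    depend on b only: f is continuous in a for the strong topology. *)
Lemma resolvent_diff (a b ha hb : bop H) :
  ha * (1 + a * a) = 1 -> (1 + a * a) * ha = 1 ->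
  (1 + b * b) * hb = 1 ->
  a * ha - b * hb = ha * ((a - b) * hb) - (a * ha) * ((a - b) * (b * hb)).
Proof.
move=> ha1 ha2 hb1.
have aha : ha * a = a * ha.
  have aC : (1 + a * a) * a = a * (1 + a * a) by rewrite mulrDl mulrDr mul1r mulr1 mulrA.
  by rewrite -[LHS]mulr1 -ha2 -!mulrA (mulrA a) -aC !mulrA ha1 mul1r.
have -> : a * ha = ha * (a * ((1 + b * b) * hb)) by rewrite hb1 mulr1 aha.
have -> : b * hb = ha * ((1 + a * a) * b * hb) by rewrite !mulrA ha1 mul1r.
rewrite -mulrBr.
have -> : ha * (a * ((1 + b * b) * hb)) = ha * a by rewrite hb1 mulr1.
rewrite -!mulrA -mulrBr; congr (ha * _).
rewrite (mulrA ha) ha1 mul1r.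
rewrite !mulrA -!mulrBl; congr (_ * hb).
rewrite !mulrBr !mulrBl !mulrDr !mulrDl !mulr1 !mul1r !mulrA opprB opprD !addrA.
by rewrite (addrAC a).
Qed.

End FixedPoints.

(** * Tracial states and their 2-norm *)

Section State.
Context {R : realType} {H : hilbertType R} {M : set (bop H)} {tau : bop H -> R[i]}.
Hypothesis vM : von_neumann_algebra M.
Hypothesis tau_state : state_on M tau.
Implicit Types (S T a b : bop H) (r : R).

Lemma stateD S T : M S -> M T -> tau (S + T) = tau S + tau T.
Proof.
by move=> MS MT; have := state_linear tau_state 1 MS MT; rewrite scale1r mul1r.
Qed.
Lemma state0 : tau 0 = 0.
Proof.
have := stateD (vna0 vM) (vna0 vM); rewrite addr0 => /eqP.
by rewrite -subr_eq0 opprD addNKr oppr_eq0 => /eqP.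
Qed.
Lemma stateZ (c : R[i]) S : M S -> tau (c *: S) = c * tau S.
Proof.
move=> MS; have := state_linear tau_state c MS (vna0 vM).
by rewrite !addr0 state0 addr0.
Qed.
Lemma stateN S : M S -> tau (- S) = - tau S.
Proof. by move=> MS; rewrite -scaleN1r stateZ// mulN1r. Qed.
Lemma stateB S T : M S -> M T -> tau (S - T) = tau S - tau T.
Proof. by move=> MS MT; rewrite stateD ?stateN//; exact: vnaN. Qed.

Lemma state_sum (I : Type) (s : seq I) (F : I -> bop H) : (forall i, M (F i)) ->
  tau (\sum_(i <- s) F i) = \sum_(i <- s) tau (F i).
Proof.
move=> MF; elim: s => [|i s IHs]; first by rewrite !big_nil state0.
rewrite !big_cons stateD ?IHs//.
by elim/big_ind: _ => //; [exact: vna0|move=> S T; exact: vnaD].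
Qed.

Definition sq_norm2 T : R := complex.Re (tau (adj T * T)).

Lemma sq_norm2_ge0 T : M T -> 0 <= sq_norm2 T.
Proof. by move=> MT; have := state_ge0 tau_state MT; rewrite lecE /= => /andP[]. Qed.

Lemma sq_norm2E T : M T -> tau (adj T * T) = (sq_norm2 T)%:C.
Proof. by move=> MT; apply: real_of_ge0; exact: (state_ge0 tau_state). Qed.

Lemma state_expand (c : R[i]) S T : M S -> M T ->
  tau (adj (S + c *: T) * (S + c *: T)) = tau (adj S * S) + c * tau (adj S * T)
    + ((c^*)%R * tau (adj T * S) + (c^*)%R * c * tau (adj T * T)).
Proof.
move=> MS MT; have vMM := vna_mul vM; have vMA := vna_adj vM.
have MSS : M (adj S * S) by apply: vMM => //; exact: vMA.
have MST : M (adj S * T) by apply: vMM => //; exact: vMA.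
have MTS : M (adj T * S) by apply: vMM => //; exact: vMA.
have MTT : M (adj T * T) by apply: vMM => //; exact: vMA.
rewrite adjD adjZ mulrDl !mulrDr !scale_mull !scale_mulr scalerA.
have cST := vnaZ vM c MST; have cTS := vnaZ vM (c^*)%R MTS.
have cTT := vnaZ vM ((c^*)%R * c) MTT.
by rewrite !stateD ?stateZ //; exact: (vnaD vM).
Qed.

(** Positivity makes c tau(T) + c^* tau(T^* ) real for every c; c = 1 and c = i decide. *)
Lemma state_adj T : M T -> tau (adj T) = ((tau T)^*)%R.
Proof.
move=> MT; have M1 := vna_one vM.
have im0 (c : R[i]) : complex.Im (c * tau T + (c^*)%R * tau (adj T)) = 0.
  have := state_ge0 tau_state (vnaD vM M1 (vnaZ vM c MT)).
  rewrite state_expand// adj1 !mul1r mulr1 sq_norm2E// (state_one tau_state).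
  rewrite lecE => /andP[/eqP + _].
  have -> : (c^*)%R * c = (nrm c ^+ 2)%:C by rewrite -normCKC nrmE rmorphXn.
  rewrite -rmorphM.
  by case: (c * _) => u v; case: (_ * tau _) => w z /=; rewrite add0r addr0.
have := im0 1; rewrite rmorph1 !mul1r; have := im0 'i.
have -> : ('i^*)%R = - 'i :> R[i] by apply/eqP; rewrite eq_complex /= oppr0 !eqxx.
case: (tau T) => u v; case: (tau (adj T)) => w z /= e1 e2.
by apply/eqP; rewrite eq_complex /=; apply/andP; split; apply/eqP; lra.
Qed.

(** The discriminant argument, applied to S - s z T with s real and z = tau(T^* S). *)
Lemma state_CauchySchwarz S T : M S -> M T ->
  nrm (tau (adj T * S)) ^+ 2 <= sq_norm2 T * sq_norm2 S.
Proof.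
move=> MS MT; set z := tau (adj T * S).
have MTS : M (adj T * S) by apply: vna_mul => //; exact: vna_adj.
have zJ : tau (adj S * T) = (z^*)%R by rewrite -state_adj// adjM adjK.
have wS := sq_norm2_ge0 MS; have wT := sq_norm2_ge0 MT.
(* The positive number tau((S - s z T)^* (S - s z T)), expanded. *)
have main s : 0 <= sq_norm2 S - 2 * s * nrm z ^+ 2 + s ^+ 2 * nrm z ^+ 2 * sq_norm2 T.
  have := state_ge0 tau_state (vnaD vM MS (vnaZ vM (- (s%:C * z)) MT)).
  rewrite state_expand// !sq_norm2E// zJ -/z.
  rewrite rmorphN rmorphM /= conj_real !mulNr mulrN mulNr opprK -!mulrA (mulrC _^*%R) -normCK.
  rewrite (mulrA _^*%R s%:C) (mulrC _^*%R s%:C) -mulrA (mulrA _^*%R z) (mulrC _^*%R z) -normCK.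
  rewrite nrmE -!rmorphXn -!rmorphM -!rmorphN -!rmorphD /= ler0c => h.
  by apply: le_trans h _; rewrite le_eqVlt; apply/orP; left; apply/eqP; ring.
have [->|n0] := eqVneq (nrm z ^+ 2) 0; first exact: mulr_ge0.
have npos : 0 < nrm z ^+ 2 by rewrite lt_neqAle eq_sym n0 sqr_ge0.
rewrite -(ler_pM2r npos) -expr2 -sqrrN mulrC mulrA.
have -> : nrm z ^+ 2 * sq_norm2 T * sq_norm2 S = sq_norm2 S * (nrm z ^+ 2 * sq_norm2 T) by ring.
apply: discriminant_le => //; first by rewrite mulr_ge0// sqr_ge0.
by move=> t; apply: le_trans (main t) _; rewrite le_eqVlt; apply/orP; left; apply/eqP; ring.
Qed.

Definition norm2 T : R := Num.sqrt (sq_norm2 T).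

Lemma norm2_ge0 T : 0 <= norm2 T. Proof. exact: sqrtr_ge0. Qed.

Lemma norm2_sq T : M T -> norm2 T ^+ 2 = sq_norm2 T.
Proof. by move=> MT; rewrite sqr_sqrtr// sq_norm2_ge0. Qed.

Lemma norm2_inner S T : M S -> M T -> nrm (tau (adj T * S)) <= norm2 T * norm2 S.
Proof.
move=> MS MT; rewrite -ler_sqr ?nnegrE ?nrm_ge0 ?mulr_ge0 ?norm2_ge0//.
by rewrite exprMn !norm2_sq// state_CauchySchwarz.
Qed.

Lemma norm2Z (c : R[i]) T : M T -> norm2 (c *: T) = nrm c * norm2 T.
Proof.
move=> MT; have MTT : M (adj T * T) by apply: vna_mul => //; exact: vna_adj.
rewrite /norm2 /sq_norm2 adjZ scale_mull scale_mulr scalerA stateZ// -normCKC nrmE.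
by rewrite -rmorphXn ReZ sqrtrM ?sqr_ge0// sqrtr_sqr ger0_norm// nrm_ge0.
Qed.

Lemma norm2N T : norm2 (- T) = norm2 T.
Proof. by rewrite /norm2 /sq_norm2 adjN mulrNN. Qed.

Lemma norm2_triangle S T : M S -> M T -> norm2 (S + T) <= norm2 S + norm2 T.
Proof.
move=> MS MT; have MST := vnaD vM MS MT.
rewrite -ler_sqr ?nnegrE ?addr_ge0 ?norm2_ge0// norm2_sq// sqrrD !norm2_sq//.
have := norm2_inner MS MT; have := norm2_inner MT MS.
have := state_expand 1 MS MT; rewrite scale1r rmorph1 !mul1r => e.
rewrite {1}/sq_norm2 e !ReD -/(sq_norm2 S) -/(sq_norm2 T).
have := normRe_le (tau (adj T * S)); have := normRe_le (tau (adj S * T)).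
rewrite !ler_norml => /andP[_ h1] /andP[_ h2] h3 h4.
rewrite mulr2n; lra.
Qed.

Lemma norm2B S T : M S -> M T -> norm2 (S - T) <= norm2 S + norm2 T.
Proof. by move=> MS MT; rewrite -(norm2N T) norm2_triangle//; exact: vnaN. Qed.

Lemma norm2_one : norm2 1 = 1.
Proof. by rewrite /norm2 /sq_norm2 adj1 mulr1 (state_one tau_state) sqrtr1. Qed.

Lemma nrm_state T : M T -> nrm (tau T) <= norm2 T.
Proof.
move=> MT; have := norm2_inner MT (vna_one vM).
by rewrite adj1 mul1r norm2_one mul1r.
Qed.

(** Left multiplication is bounded for the 2-norm because r^2 - a^* a has a square
    root in M up to the harmless factor 3/4 required by the contraction. *)
Lemma norm2_mull r a b : M a -> M b -> 0 < r -> bounded_by r a ->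
  norm2 (a * b) <= 2 * r * norm2 b.
Proof.
move=> Ma Mb r0 ar; have vMM := vna_mul vM; have vMA := vna_adj vM.
pose c := (3/4) * r^-1 ^+ 2; have c0 : 0 <= c by rewrite mulr_ge0 ?sqr_ge0//; lra.
have Maa : M (adj a * a) by apply: vMM => //; exact: vMA.
have [|||V [MV V_sa VE]] := @sqrt_one_sub _ _ M (c%:C *: (adj a * a)) vM.
- exact: vnaZ.
- by rewrite /self_adjoint adjZ conj_real adjM adjK.
- have -> : 3/4 = nrm c%:C * (r * r) :> R.
    rewrite nrm_real ger0_norm// /c; field; by rewrite gt_eqF.
  apply: bounded_byZ; apply: bounded_byM => //; first exact: ltW.
  by apply: bounded_by_adj => //; exact: ltW.
have MVb : M (V * b) by exact: vMM.
have := sq_norm2_ge0 MVb; rewrite /sq_norm2.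
have -> : adj (V * b) * (V * b) = adj b * b - c%:C *: (adj (a * b) * (a * b)).
  rewrite !adjM V_sa -mulrA (mulrA V) VE mulrBl mul1r mulrBr scale_mull scale_mulr.
  by rewrite !mulrA.
have ab : M (a * b) by exact: vMM.
have Mab : M (adj (a * b) * (a * b)) by apply: vMM => //; exact: vMA.
have Mbb : M (adj b * b) by apply: vMM => //; exact: vMA.
have cMab := vnaZ vM c%:C Mab.
rewrite stateB ?stateZ//.
rewrite ReD ReN ReZ -/(sq_norm2 _) -/(sq_norm2 _) -!norm2_sq//.
rewrite subr_ge0 => h.
have nb := norm2_ge0 b.
rewrite -ler_sqr ?nnegrE ?norm2_ge0 ?mulr_ge0// ?(ltW r0)//.
set X := norm2 (a * b) ^+ 2 in h *.
have {h} : 3/4 * X <= norm2 b ^+ 2 * r ^+ 2.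
  have := ler_wpM2r (sqr_ge0 r) h; congr (_ <= _).
  by rewrite /c; field; by rewrite gt_eqF.
have : 0 <= norm2 b ^+ 2 * r ^+ 2 by rewrite mulr_ge0 ?sqr_ge0.
rewrite !exprMn; set Y := _ * r ^+ 2; rewrite [_ * _ * norm2 b ^+2](_ : _ = 4 * Y).
  by lra.
by rewrite /Y; ring.
Qed.

Hypothesis tau_trace : tracial_on M tau.

Lemma norm2_adj T : M T -> norm2 (adj T) = norm2 T.
Proof.
by move=> MT; rewrite /norm2 /sq_norm2 adjK tau_trace//; exact: vna_adj.
Qed.

(** This is where traciality enters: the adjoint preserves the 2-norm. *)
Lemma norm2_mulr r a b : M a -> M b -> 0 < r -> bounded_by r a ->
  norm2 (b * a) <= 2 * r * norm2 b.
Proof.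
move=> Ma Mb r0 ar; rewrite -norm2_adj; last exact: vna_mul.
rewrite adjM -(norm2_adj Mb); apply: norm2_mull => //; try exact: vna_adj.
by apply: bounded_by_adj => //; exact: ltW.
Qed.

Hypothesis tau_faithful : faithful_on M tau.

Lemma norm2_eq0 T : M T -> norm2 T = 0 -> T = 0.
Proof.
move=> MT T0; apply: tau_faithful => //.
by rewrite sq_norm2E// -norm2_sq// T0 expr0n.
Qed.

End State.
Arguments sq_norm2 {R H} tau T.
Arguments norm2 {R H} tau T.

(** * Normal functionals on bounded sets *)

Section Normality.
Context {R : realType} {H : hilbertType R}.
Implicit Types (S T : bop H) (r e : R).

Lemma cvgn_dist (u : nat -> R[i]) (l : R[i]) : u @ \oo --> l ->
  forall e, 0 < e -> exists n, forall k, (n <= k)%N -> nrm (l - u k) < e.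
Proof.
move=> /cvgrPdist_lt ul e e0; have [|n _ un] := ul e%:C; first by rewrite ltcR.
by exists n => k nk; have := un k nk; rewrite nrmE ltcR.
Qed.

Lemma square_summable_tail (x : nat -> H) : square_summable x ->
  forall e, 0 < e -> exists n, forall k m, (n <= k)%N ->
    \sum_(k <= j < m) nrm (x j) ^+ 2 <= e.
Proof.
move=> /cvg_ex[/= l xl] e e0; have e2 : 0 < e / 2 by rewrite divr_gt0.
have [n xn] := cvgn_dist xl e2; exists n => k m nk.
have [mk|km] := leqP m k; first by rewrite big_geq// ltW.
have := sub_series_geq (fun j => `|x j| ^+ 2) (ltnW km) => /(congr1 (@nrm R R[i])) E.
have sE : \sum_(k <= j < m) `|x j| ^+ 2 = (\sum_(k <= j < m) nrm (x j) ^+ 2)%:C.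
  by rewrite rmorph_sum; apply: eq_bigr => j _; rewrite nrmE rmorphXn.
have := nrm_dist l (series (fun j => `|x j| ^+ 2) m) (series (fun j => `|x j| ^+ 2) k).
rewrite E sE nrm_real ger0_norm ?sumr_ge0//; last by move=> j _; exact: sqr_ge0.
rewrite nrm_distC => /le_trans; apply; rewrite (splitr e); apply: lerD; apply/ltW/xn => //.
exact: leq_trans nk (ltnW km).
Qed.

(** The tail of the series of <S x_j, y_j> is at most r times the sum of the tails of
    |x_j|^2 and |y_j|^2, uniformly over S bounded by r. *)
Lemma ultraweak_functional_small (x y : nat -> H) r e :
  square_summable x -> square_summable y -> 0 <= r -> 0 < e ->
  exists n, forall k, (n <= k)%N -> forall S, bounded_by r S ->
    nrm (ultraweak_functional x y S) <= \sum_(0 <= j < k) nrm (inner (S (x j)) (y j)) + e.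
Proof.
move=> xs ys r0 e0; pose d := e / (2 * (r + 1)).
have d0 : 0 < d by rewrite divr_gt0// mulr_gt0// ltr_wpDl.
have [nx xn] := square_summable_tail xs d0; have [ny yn] := square_summable_tail ys d0.
exists (maxn nx ny) => k; rewrite geq_max => /andP[nxk nyk] S Sr.
set B := \sum_(0 <= j < k) _.
have B0 : 0 <= B by rewrite sumr_ge0// => j _; exact: nrm_ge0.
have rd : r * (d + d) <= e.
  have dE : d * (2 * (r + 1)) = e by rewrite divfK// gt_eqF// mulr_gt0// ltr_wpDl.
  nra.
set u := fun n => inner (S (x n)) (y n).
have part m : (k <= m)%N -> nrm (series u m) <= B + e.
  move=> km; rewrite /series /= (big_cat_nat (leq0n k) km)//=.
  apply: le_trans (nrm_triangle _ _) _; apply: lerD; first exact: nrm_sum.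
  apply: le_trans (nrm_sum _ _ _) _; apply: le_trans _ rd.
  apply: (@le_trans _ _ (\sum_(k <= j < m) r * (nrm (x j) ^+ 2 + nrm (y j) ^+ 2))).
    apply: ler_sum => j _; apply: le_trans (nrm_inner _ _) _.
    apply: le_trans (ler_wpM2r (nrm_ge0 _) (Sr _)) _.
    by rewrite -mulrA ler_wpM2l//; have := sqr_ge0 (nrm (x j) - nrm (y j)); have := nrm_ge0 (x j); have := nrm_ge0 (y j); nra.
  rewrite -mulr_sumr ler_wpM2l// big_split /=; apply: lerD; [exact: xn|exact: yn].
rewrite /ultraweak_functional -/u.
(* The limit of a divergent series is the default value 0, for which the bound is clear. *)
have [/cvg_ex[/= l ul]|/dvgP ->] := pselect (cvgn (series u)); last first.
  by rewrite (_ : point = 0 :> R[i])// nrm0 addr_ge0// ltW.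
rewrite (cvg_lim _ ul)//; apply/ler_addgt0Pr => z z0.
have [n un] := cvgn_dist ul z0.
rewrite -(subrK (series u (maxn k n)) l) addrC; apply: le_trans (nrm_triangle _ _) _.
by apply: lerD; [apply: part; exact: leq_maxl|apply/ltW/un; exact: leq_maxr].
Qed.

(** On bounded sets the tails of the square summable sequences are uniformly small, so
    that a normal functional is controlled by finitely many matrix coefficients. *)
Lemma normal_on_bounded (M : set (bop H)) (tau : bop H -> R[i]) r e :
  von_neumann_algebra M -> state_on M tau -> normal_on M tau -> 0 <= r -> 0 < e ->
  exists (s : seq (H * H)) (d : R), 0 < d /\
    forall S, M S -> bounded_by r S ->
      (forall p, p \in s -> nrm (inner (S p.1) p.2) <= d) -> nrm (tau S) < e.
Proof.
move=> vM tauS tauN r0 e0.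
have [|m [x [y [_ [/ltc_real[D D0 ->] xy tau_small]]]]] := tauN 0 e%:C (vna0 vM).
  by rewrite ltcR.
have D4 : 0 < D / 2 by rewrite divr_gt0.
have /choice[n xyn] i : exists n, forall k, (n <= k)%N -> forall S, bounded_by r S ->
    nrm (ultraweak_functional (x i) (y i) S) <=
      \sum_(0 <= j < k) nrm (inner (S (x i j)) (y i j)) + D / 2.
  by have [xs ys] := xy i; exact: ultraweak_functional_small.
pose k := \max_(i < m) n i.
exists (flatten [seq [seq (x i j, y i j) | j <- iota 0 k] | i <- enum 'I_m]).
pose d := D / (4 * (k%:R + 1)).
have k1 : 0 < k%:R + 1 :> R by rewrite ltr_wpDl.
have d0 : 0 < d by rewrite divr_gt0// mulr_gt0.
exists d; split => // S MS Sr small.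
suff : `|tau S - tau 0| < e%:C by rewrite (state0 vM tauS) subr0 nrmE ltcR.
apply: tau_small => // i.
rewrite subr0 nrmE ltcR; apply: le_lt_trans (xyn i k _ S Sr) _; first exact: leq_bigmax.
apply: (@le_lt_trans _ _ (\sum_(0 <= j < k) d + D / 2)).
  rewrite lerD2r big_nat [leRHS]big_nat; apply: ler_sum => j /andP[_ jk].
  apply: (small (x i j, y i j)); apply/flatten_mapP; exists i; first by rewrite mem_enum.
  by apply/mapP; exists j => //; rewrite mem_iota.
rewrite big_const_nat subn0 iter_addr addr0 -mulr_natl /d.
have : k%:R * (D / (4 * (k%:R + 1))) < D / 2.
  have -> : k%:R * (D / (4 * (k%:R + 1))) = k%:R * D / (4 * (k%:R + 1)) by rewrite mulrA.
  rewrite ltr_pdivrMr ?mulr_gt0//; have := ler0n R k; nra.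
by lra.
Qed.

End Normality.

(** * Strong approximation by self-adjoint elements *)

Section RealInner.
Context {R : realType} {H : hilbertType R}.
Implicit Types (x y z : H).

Definition rinner x y : R := complex.Re (inner x y).

Lemma rinnerC x y : rinner x y = rinner y x.
Proof. by rewrite /rinner innerC Re_conj. Qed.
Lemma rinnerDl x y z : rinner (x + y) z = rinner x z + rinner y z.
Proof. by rewrite /rinner innerDl ReD. Qed.
Lemma rinnerBl x y z : rinner (x - y) z = rinner x z - rinner y z.
Proof. by rewrite /rinner innerBl ReD ReN. Qed.
Lemma rinnerDr x y z : rinner x (y + z) = rinner x y + rinner x z.
Proof. by rewrite !(rinnerC x) rinnerDl. Qed.
Lemma rinnerBr x y z : rinner x (y - z) = rinner x y - rinner x z.
Proof. by rewrite !(rinnerC x) rinnerBl. Qed.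
Lemma rinnerZl (t : R) x y : rinner (t%:C *: x) y = t * rinner x y.
Proof. by rewrite /rinner innerZl ReZ. Qed.
Lemma rinnerZr (t : R) x y : rinner x (t%:C *: y) = t * rinner x y.
Proof. by rewrite !(rinnerC x) rinnerZl. Qed.
Lemma rinnerxx x : rinner x x = nrm x ^+ 2.
Proof. by rewrite /rinner innerxx. Qed.
Lemma rinner_le x y : `|rinner x y| <= nrm x * nrm y.
Proof. exact: le_trans (normRe_le _) (nrm_inner _ _). Qed.

End RealInner.

Section WotClosure.
Context {R : realType} {H : hilbertType R}.
Implicit Types (S T p : bop H) (x y : H) (A : set (bop H)).

Record star_algebra A : Prop := StarAlgebra {
  sta_one : A 1;
  sta_linear : forall (a : R[i]) S T, A S -> A T -> A (a *: S + T);
  sta_mul : forall S T, A S -> A T -> A (S * T);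
  sta_adj : forall T, A T -> A (adj T) }.

Lemma wot_closureP A T : wot_closure A T <->
  forall (s : seq (H * H)) (e : R), 0 < e ->
    exists2 S, A S & forall q, q \in s -> nrm (inner (S q.1 - T q.1) q.2) < e.
Proof.
split=> [AT s e e0|AT m x y _ /ltc_real[e e0 ->]].
  pose q (i : 'I_(size s)) := nth (0, 0) s i.
  have [|S AS ST] := AT (size s) (fun i => (q i).1) (fun i => (q i).2) e%:C.
    by rewrite ltcR.
  exists S => // p /(nthP (0, 0))[i si <-].
  by have := ST (Ordinal si); rewrite nrmE ltcR.
have [S AS ST] := AT [seq (x i, y i) | i <- enum 'I_m] e e0.
exists S => // i; rewrite nrmE ltcR; apply: (ST (x i, y i)).
by apply/mapP; exists i => //; rewrite mem_enum.
Qed.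

Lemma wot_closure_sub A : A `<=` wot_closure A.
Proof.
move=> T AT; apply/wot_closureP => s e e0; exists T => // q _.
by rewrite subrr inner0l nrm0.
Qed.

(** Multiplication is not jointly continuous, but p q - S T = p (q - T) + (p - S) T
    allows p to be chosen first, and then q depending on p. *)
Lemma wot_closure_vna A : star_algebra A -> von_neumann_algebra (wot_closure A).
Proof.
move=> sA; split.
- by apply: wot_closure_sub; exact: sta_one.
- move=> a S T /wot_closureP AS /wot_closureP AT; apply/wot_closureP => s e e0.
  have a1 : 0 < nrm a + 1 by rewrite ltr_wpDl ?nrm_ge0.
  have [|p Ap pS] := AS s (e / 2 / (nrm a + 1)); first by rewrite !divr_gt0.
  have [|q Aq qT] := AT s (e / 2); first by rewrite divr_gt0.
  exists (a *: p + q); first exact: sta_linear.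
  move=> v sv; have {}pS := pS v sv; have {}qT := qT v sv.
  rewrite !bopE opprD addrACA -scalerBr innerDl innerZl; apply: le_lt_trans (nrm_triangle _ _) _.
  rewrite (splitr e); apply: ler_ltD => //; rewrite nrmM.
  move: pS; rewrite ltr_pdivlMr// => /ltW; apply: le_trans.
  by rewrite mulrC ler_wpM2l ?nrm_ge0// lerDl.
- move=> S T /wot_closureP AS /wot_closureP AT; apply/wot_closureP => s e e0.
  have e2 : 0 < e / 2 by rewrite divr_gt0.
  have [p Ap pS] := AS [seq (T v.1, v.2) | v <- s] (e / 2) e2.
  have [q Aq qT] := AT [seq (v.1, adj p v.2) | v <- s] (e / 2) e2.
  exists (p * q); first exact: sta_mul.
  move=> v sv; rewrite !bopE.
  have -> : p (q v.1) - S (T v.1) = p (q v.1 - T v.1) + (p (T v.1) - S (T v.1)).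
    by rewrite bopB addrA subrK.
  rewrite innerDl adjP; apply: le_lt_trans (nrm_triangle _ _) _.
  rewrite (splitr e) ltrD//; first by apply: (qT (v.1, adj p v.2)); apply/mapP; exists v.
  by apply: (pS (T v.1, v.2)); apply/mapP; exists v.
- move=> T /wot_closureP AT; apply/wot_closureP => s e e0.
  have [p Ap pT] := AT [seq (v.2, v.1) | v <- s] e e0.
  exists (adj p); first exact: sta_adj.
  move=> v sv; rewrite innerBl !adjPl -innerBr innerC nrm_conj.
  by apply: (pT (v.2, v.1)); apply/mapP; exists v.
- move=> T /wot_closureP AT; apply/wot_closureP => s e e0.
  have e2 : 0 < e / 2 by rewrite divr_gt0.
  have [S /wot_closureP AS ST] := AT s (e / 2) e2.
  have [p Ap pS] := AS s (e / 2) e2.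
  exists p => // v sv; have -> : p v.1 - T v.1 = (p v.1 - S v.1) + (S v.1 - T v.1).
    by rewrite addrA subrK.
  rewrite innerDl; apply: le_lt_trans (nrm_triangle _ _) _.
  by rewrite (splitr e) ltrD//; [exact: pS|exact: ST].
Qed.

Lemma sta_scale A (a : R[i]) T : star_algebra A -> A T -> A (a *: T).
Proof.
move=> sA AT; have A0 : A 0.
  by rewrite -(addNr T) -scaleN1r; exact: sta_linear.
by rewrite -(addr0 (a *: T)); exact: sta_linear.
Qed.

Lemma sta_add A S T : star_algebra A -> A S -> A T -> A (S + T).
Proof. by move=> sA AS AT; rewrite -(scale1r S); exact: sta_linear. Qed.

(** The adjoint is weakly continuous, so approximants can be replaced by their
    self-adjoint parts. *)
Lemma wot_self_adjoint A T (s : seq (H * H)) (e : R) :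
  star_algebra A -> self_adjoint T -> wot_closure A T -> 0 < e ->
  exists p, [/\ A p, self_adjoint p &
    forall q, q \in s -> nrm (inner (p q.1 - T q.1) q.2) < e].
Proof.
move=> sA T_sa /wot_closureP AT e0.
have [p Ap pT] := AT (s ++ [seq (v.2, v.1) | v <- s]) e e0.
pose h : R[i] := (2^-1 : R)%:C.
have hh : h + h = 1 by rewrite -rmorphD; congr (_%:C); lra.
exists (h *: (p + adj p)); split.
- by apply: sta_scale => //; apply: sta_add => //; exact: sta_adj.
- by rewrite /self_adjoint adjZ conj_real adjD adjK addrC.
move=> v sv; have -> : (h *: (p + adj p)) v.1 - T v.1 =
    h *: (p v.1 - T v.1) + h *: (adj p v.1 - adj T v.1).
  rewrite bopZE bopDE T_sa -scalerDr addrACA -opprD scalerBr (scalerDr _ (T _)) -scalerDl hh.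
  by rewrite scale1r.
rewrite innerDl !innerZl innerBl (innerBl (adj p _)) !adjPl -innerBl -innerBr (innerC v.1).
apply: le_lt_trans (nrm_triangle _ _) _.
rewrite !nrmM nrm_conj nrm_real ger0_norm ?invr_ge0//.
have : nrm (inner (p v.1 - T v.1) v.2) < e by apply: pT; rewrite mem_cat sv.
have : nrm (inner (p v.2 - T v.2) v.1) < e.
  by apply: (pT (v.2, v.1)); rewrite mem_cat; apply/orP; right; apply/mapP; exists v.
lra.
Qed.

(** Mazur's theorem for the real vector space of self-adjoint elements of A.  A
    sequence p_l in it minimising the distance from (p x_i)_i to (T x_i)_i has
    convergent images p_l x_i; the residuals are orthogonal to all (q x_i)_i, hence
    to (T x_i)_i by weak density, and so they vanish. *)
Lemma strong_self_adjoint A T (s : seq H) (e : R) :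
  star_algebra A -> self_adjoint T -> wot_closure A T -> 0 < e ->
  exists p, [/\ A p, self_adjoint p & forall x, x \in s -> nrm (p x - T x) < e].
Proof.
move=> sA T_sa AT e0; pose n := size s; pose x (i : 'I_n) := nth 0 s i.
pose Asa p := A p /\ self_adjoint p.
have AsaD p q : Asa p -> Asa q -> Asa (p + q).
  move=> [Ap p_sa] [Aq q_sa]; split; first exact: sta_add.
  by rewrite /self_adjoint adjD p_sa q_sa.
have AsaZ (t : R) p : Asa p -> Asa (t%:C *: p).
  move=> [Ap p_sa]; split; first exact: sta_scale.
  by rewrite /self_adjoint adjZ conj_real p_sa.
have AsaB p q : Asa p -> Asa q -> Asa (p - q).
  move=> Ap Aq; have -> : p - q = p + (-1 : R)%:C *: q by rewrite rmorphN scaleN1r.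
  by apply: AsaD => //; exact: AsaZ.
pose E p := \sum_i nrm (p (x i) - T (x i)) ^+ 2.
pose Q (q : bop H) := \sum_i nrm (q (x i)) ^+ 2.
pose B p (q : bop H) := \sum_i rinner (p (x i) - T (x i)) (q (x i)).
have E0 p : 0 <= E p by apply: sumr_ge0 => i _; exact: sqr_ge0.
have Q0 q : 0 <= Q q by apply: sumr_ge0 => i _; exact: sqr_ge0.
(* E is quadratic on lines, with polar form B and leading coefficient Q. *)
have EE p q t : E (p + t%:C *: q) = E p + 2 * t * B p q + t ^+ 2 * Q q.
  rewrite /E /B /Q !mulr_sumr -!big_split /=; apply: eq_bigr => i _.
  have e1 : (p + t%:C *: q : bop H) (x i) - T (x i) = p (x i) - T (x i) + t%:C *: q (x i).
    by rewrite !bopE addrAC.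
  rewrite -!rinnerxx e1; move: (p (x i) - T (x i)) (q (x i)) => a b.
  by rewrite !(rinnerDl, rinnerDr, rinnerZl, rinnerZr) (rinnerC b a); ring.
have hE : has_inf [set E p | p in Asa].
  split; last by exists 0 => _ [p _ <-].
  by exists (E 1), 1 => //; split; [exact: sta_one|exact: adj1].
set d := inf [set E p | p in Asa].
have dE p : Asa p -> d <= E p by move=> Ap; apply: ge_inf; [case: hE|exists p].
(* At an approximate minimum the first variation of E is small. *)
have var p q eta : Asa p -> Asa q -> E p <= d + eta -> B p q ^+ 2 <= eta * Q q.
  move=> Ap Aq Ep; apply: discriminant_le => //.
    by have := dE p Ap; lra.
  move=> t; have := dE _ (AsaD _ _ Ap (AsaZ t _ Aq)); rewrite EE; lra.
have eta0 l : 0 < (l.+1%:R ^- 2 : R) by rewrite invr_gt0 exprn_gt0.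
have /choice[p pP] (l : nat) : exists p, Asa p /\ E p <= d + l.+1%:R ^- 2.
  by have [_ [p Ap <-] /ltW] := inf_adherent (eta0 l) hE; exists p.
have BQ l q : Asa q -> `|B (p l) q| <= l.+1%:R^-1 * Num.sqrt (Q q).
  move=> Aq; have [Ap Ep] := pP l.
  rewrite -ler_sqr ?nnegrE ?mulr_ge0 ?sqrtr_ge0 ?invr_ge0// real_normK ?num_real//.
  by rewrite exprMn sqr_sqrtr// exprVn var.
have xQ (q : bop H) i : nrm (q (x i)) <= Num.sqrt (Q q).
  rewrite -[leLHS]ger0_norm ?nrm_ge0// -sqrtr_sqr ler_sqrt// /Q (bigD1 i)//= lerDl.
  by apply: sumr_ge0 => j _; exact: sqr_ge0.
(* Taking q = p_l - p_m in the first variation shows that the sequence is Cauchy. *)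
have pC l m : Num.sqrt (Q (p l - p m)) <= l.+1%:R^-1 + m.+1%:R^-1.
  have Aq : Asa (p l - p m) by apply: AsaB; [case: (pP l)|case: (pP m)].
  apply: le_of_sq_le; first by rewrite addr_ge0// invr_ge0.
  rewrite -expr2 sqr_sqrtr// mulrDl.
  have QE : Q (p l - p m) = B (p l) (p l - p m) - B (p m) (p l - p m).
    rewrite /Q /B -sumrB; apply: eq_bigr => i _; rewrite -rinnerBl -rinnerxx.
    by rewrite !bopE opprB addrA subrK.
  rewrite [leLHS]QE; have := BQ l _ Aq; have := BQ m _ Aq; rewrite !ler_norml => /andP[h1 _] /andP[_ h2].
  by apply: lerD h2 _; rewrite lerNl.
have inv_small (eps : R) : 0 < eps -> exists l0, forall l : nat, (l0 <= l)%N -> l.+1%:R^-1 < eps.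
  move=> eps0; have [k] := ltr_add_invr eps0; rewrite add0r => ke.
  exists k => l kl; apply: le_lt_trans ke.
  by rewrite lef_pV2 ?posrE// ler_nat.
have /choice[z zP] i : exists z, forall eps : R, 0 < eps -> exists l0,
    forall l, (l0 <= l)%N -> nrm (z - p l (x i)) < eps.
  apply: hilbert_complete => eps eps0.
  have [|l0 l0P] := inv_small (eps / 2); first by rewrite divr_gt0.
  exists l0 => l m ll0 ml0; rewrite -bopBE; apply: le_lt_trans (xQ _ i) _.
  apply: le_lt_trans (pC l m) _; rewrite (splitr eps) ltrD//; exact: l0P.
pose w i := z i - T (x i).
have zP' (eps : R) : 0 < eps -> exists l0, forall l, (l0 <= l)%N -> forall i,
    nrm (z i - p l (x i)) < eps.
  move=> eps0; have /choice[f fP] i := zP i eps eps0.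
  exists (\max_i f i) => l fl i; apply: fP; apply: leq_trans fl; exact: leq_bigmax.
have small0 (f c : R) : 0 <= c ->
    (forall eps : R, 0 < eps -> `|f| <= eps * (c + 1)) -> f = 0.
  move=> c0 fc; apply/eqP; rewrite -normr_le0; apply/ler_addgt0Pr => eps eps0.
  have c1 : 0 < c + 1 by rewrite ltr_wpDl.
  have := fc (eps / (c + 1)); rewrite add0r divfK ?gt_eqF//; apply.
  by rewrite divr_gt0.
have sum_le (eps : R) (u v : 'I_n -> H) : (forall i, nrm (v i) <= eps) ->
    `|\sum_i rinner (v i) (u i)| <= eps * \sum_i nrm (u i).
  move=> veps; apply: le_trans (ler_norm_sum _ _ _) _; rewrite mulr_sumr.
  apply: ler_sum => i _; apply: le_trans (rinner_le _ _) _.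
  by rewrite ler_wpM2r ?nrm_ge0.
have sum_ge0 (u : 'I_n -> H) : 0 <= \sum_i nrm (u i).
  by apply: sumr_ge0 => i _; exact: nrm_ge0.
have worth q : Asa q -> \sum_i rinner (w i) (q (x i)) = 0.
  move=> Aq; apply: (small0 _ (Num.sqrt (Q q) + \sum_i nrm (q (x i)))).
    by rewrite addr_ge0 ?sqrtr_ge0.
  move=> eps eps0.
  have [l1 l1P] := inv_small _ eps0; have [l2 l2P] := zP' _ eps0.
  pose l := maxn l1 l2.
  have -> : \sum_i rinner (w i) (q (x i)) =
      B (p l) q + \sum_i rinner (z i - p l (x i)) (q (x i)).
    rewrite /B -big_split /=; apply: eq_bigr => i _; rewrite -rinnerDl; congr rinner.
    by rewrite addrC addrA subrK.
  apply: le_trans (ler_normD _ _) _.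
  have h1 : `|B (p l) q| <= eps * Num.sqrt (Q q).
    apply: le_trans (BQ l q Aq) _; rewrite ler_wpM2r ?sqrtr_ge0// ltW// l1P//.
    exact: leq_maxl.
  have h2 := sum_le eps (fun i => q (x i)) (fun i => z i - p l (x i))
    (fun i => ltW (l2P l (leq_maxr _ _) i)).
  by apply: le_trans (lerD h1 h2) _; rewrite -mulrDr ler_pM2l// lerDl.
have wz : \sum_i rinner (w i) (z i) = 0.
  apply: (small0 _ (\sum_i nrm (w i))) => // eps eps0.
  have [l lP] := zP' _ eps0.
  have -> : \sum_i rinner (w i) (z i) = \sum_i rinner (z i - p l (x i)) (w i).
    rewrite -[RHS]addr0 -[X in _ = _ + X](worth (p l) (proj1 (pP l))).
    rewrite -big_split /=; apply: eq_bigr => i _.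
    by rewrite rinnerC rinnerBl (rinnerC (w i)) subrK.
  apply: le_trans (sum_le eps _ _ (fun i => ltW (lP l (leqnn l) i))) _.
  by rewrite ler_pM2l// lerDl.
have wT : \sum_i rinner (w i) (T (x i)) = 0.
  apply: (small0 _ n%:R) => // eps eps0.
  have [q [Aq q_sa qT]] := wot_self_adjoint [seq (x i, w i) | i <- enum 'I_n] sA T_sa AT eps0.
  have -> : \sum_i rinner (w i) (T (x i)) = - \sum_i rinner (q (x i) - T (x i)) (w i).
    rewrite -sumrN -[LHS]subr0 -[X in _ - X = _](worth q (conj Aq q_sa)) -sumrB; apply: eq_bigr => i _.
    by rewrite rinnerBl opprB !(rinnerC (w i)).
  rewrite normrN; apply: le_trans (ler_norm_sum _ _ _) _.
  apply: (@le_trans _ _ (\sum_(i < n) eps)).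
    apply: ler_sum => i _; apply: le_trans (normRe_le _) _; apply: ltW.
    by apply: (qT (x i, w i)); apply/mapP; exists i => //; rewrite mem_enum.
  by rewrite sumr_const card_ord -[leLHS]mulr_natr ler_pM2l// lerDl.
have w0 i : w i = 0.
  have : \sum_i nrm (w i) ^+ 2 = 0.
    rewrite -[RHS](subrr 0) -[X in _ = X - _]wz -[X in _ = _ - X]wT -sumrB; apply: eq_bigr => j _.
    by rewrite -rinnerBr -rinnerxx.
  move/eqP; rewrite psumr_eq0 => [|j _]; last exact: sqr_ge0.
  by move/allP/(_ i (mem_index_enum _)) => /=; rewrite sqrf_eq0 => /eqP/nrm_eq0.
have [l lP] := zP' e e0; have [[Ap p_sa] _] := pP l.
exists (p l); split => // y /(nthP 0)[i si <-].
have := lP l (leqnn l) (Ordinal si); have /eqP := w0 (Ordinal si).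
by rewrite subr_eq0 => /eqP ->; rewrite nrm_distC.
Qed.

End WotClosure.

(** * Simultaneous Kaplansky density *)

(** The pairs (p(X), p(Y)) of values of one noncommutative polynomial p.  As a relation,
    it needs no well-definedness: that equal values on one side have equal values on the
    other is a consequence of the equality of moments. *)
Inductive joint_alg (R : realType) (H K : hilbertType R) (I : Type)
    (X : I -> bop H) (Y : I -> bop K) : bop H -> bop K -> Prop :=
| joint_one : joint_alg X Y 1 1
| joint_gen i : joint_alg X Y (X i) (Y i)
| joint_lin (a : R[i]) S S' T T' : joint_alg X Y S S' -> joint_alg X Y T T' ->
    joint_alg X Y (a *: S + T) (a *: S' + T')
| joint_mul S S' T T' : joint_alg X Y S S' -> joint_alg X Y T T' ->
    joint_alg X Y (S * T) (S' * T').

Section JointAlgebra.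
Context {R : realType} {H K : hilbertType R} {I : Type}.
Context {X : I -> bop H} {Y : I -> bop K}.
Hypothesis X_sa : forall i, self_adjoint (X i).
Hypothesis Y_sa : forall i, self_adjoint (Y i).

Lemma joint_sym S T : joint_alg X Y S T -> joint_alg Y X T S.
Proof.
by elim=> *; [exact: joint_one|exact: joint_gen|exact: joint_lin|exact: joint_mul].
Qed.

Lemma joint_adj S T : joint_alg X Y S T -> joint_alg X Y (adj S) (adj T).
Proof.
elim=> [|i|a S1 S2 T1 T2 _ IS _ IT|S1 S2 T1 T2 _ IS _ IT].
- by rewrite !adj1; exact: joint_one.
- by rewrite X_sa Y_sa; exact: joint_gen.
- by rewrite !adj_lin; exact: joint_lin.
- by rewrite !adjM; exact: joint_mul.
Qed.

Lemma joint0 : joint_alg X Y 0 0.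
Proof.
have := joint_lin (-1) (joint_one X Y) (joint_one X Y).
by rewrite !scaleN1r !addNr.
Qed.

Lemma joint_scale (a : R[i]) S T : joint_alg X Y S T -> joint_alg X Y (a *: S) (a *: T).
Proof. by move=> ST; have := joint_lin a ST joint0; rewrite !addr0. Qed.

Lemma joint_add S S' T T' : joint_alg X Y S S' -> joint_alg X Y T T' ->
  joint_alg X Y (S + T) (S' + T').
Proof. by move=> SS TT; have := joint_lin 1 SS TT; rewrite !scale1r. Qed.

Lemma joint_sub S S' T T' : joint_alg X Y S S' -> joint_alg X Y T T' ->
  joint_alg X Y (S - T) (S' - T').
Proof.
move=> SS TT; apply: joint_add => //.
by rewrite -(scaleN1r T) -(scaleN1r T'); exact: joint_scale.
Qed.

Lemma joint_mem (M : set (bop H)) S T : von_neumann_algebra M ->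
  (forall i, M (X i)) -> joint_alg X Y S T -> M S.
Proof.
move=> vM MX; elim=> // [|a S1 S2 T1 T2 _ ? _ ?|S1 S2 T1 T2 _ ? _ ?].
- exact: vna_one.
- exact: vna_linear.
- exact: vna_mul.
Qed.

Lemma joint_neumann (c : R) p q l :
  joint_alg X Y p q -> joint_alg X Y (neumann c p l) (neumann c q l).
Proof.
move=> pq; elim: l => [|l IHl] /=; first exact: joint0.
apply: joint_add; first by apply: joint_scale; exact: joint_one.
apply: joint_mul => //; apply: joint_sub; first exact: joint_one.
apply: joint_scale; apply: joint_add; first exact: joint_one.
exact: joint_mul.
Qed.

Lemma joint_star_algebra : star_algebra [set S | exists T, joint_alg X Y S T].
Proof.
split=> [|a S T [S' SS] [T' TT]|S T [S' SS] [T' TT]|T [T' TT]].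
- by exists 1; exact: joint_one.
- by exists (a *: S' + T'); exact: joint_lin.
- by exists (S' * T'); exact: joint_mul.
- by exists (adj T'); exact: joint_adj.
Qed.

(** Taking the self-adjoint part of the pair fixes p. *)
Lemma joint_self_adjoint p q : self_adjoint p -> joint_alg X Y p q ->
  exists2 q', self_adjoint q' & joint_alg X Y p q'.
Proof.
move=> p_sa pq; pose h : R[i] := (2^-1 : R)%:C.
have hh : h + h = 1 by rewrite -rmorphD; congr (_%:C); lra.
exists (h *: (q + adj q)); first by rewrite /self_adjoint adjZ conj_real adjD adjK addrC.
have := joint_scale h (joint_add pq (joint_adj pq)).
by rewrite p_sa scalerDr -scalerDl hh scale1r.
Qed.

Context {M : set (bop H)} {tau : bop H -> R[i]}.
Hypothesis M_gen : vna_generated_by X M.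
Hypothesis tauP : normal_faithful_tracial_state M tau.

(** T is written as f(x) with f(t) = t / (1 + t^2) and x in M.  The map f is strongly
    continuous on self-adjoint operators and takes values in the unit ball, so strong
    approximants p of x give bounded strong approximants f(p) of T.  Since f(p) and
    f(q) are norm limits of the same polynomials in p and in q, the bound holds on both
    sides of the pair without knowing how the two norms compare. *)
Lemma simultaneous_kaplansky T (e : R) : M T -> self_adjoint T ->
  bounded_by (1/4) T -> 0 < e ->
  exists p q, [/\ joint_alg X Y p q, bounded_by 2 p, bounded_by 2 q &
    norm2 tau (T - p) < e].
Proof.
move=> MT T_sa T4 e0; have [vM MX M_min] := M_gen.
have tauS := nft_state tauP.
have [|||x [Mx x_sa xE]] := quadratic_fixed_point vM MT MT T_sa T_sa.
- by [].
- by apply: bounded_by_le T4; lra.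
- by apply: bounded_by_le T4; lra.
have [rx rx0 xr] := bounded_by_ex x.
have [hx [_ hx1 _]] := neumann_cvg (ltW rx0) x_sa xr.
have TE : T = x * hx.
  rewrite -[LHS]mulr1 -hx1 mulrA; congr (_ * _).
  by rewrite mulrDr mulr1 -xE.
have e2 : 0 < e ^+ 2 by rewrite exprn_gt0.
(* T - p will be bounded by 1/4 + 2 <= 3, hence (T - p)^* (T - p) by 9. *)
have r9 : 0 <= 9 :> R by [].
have [s [d [d0 small]]] := normal_on_bounded vM tauS (nft_normal tauP) r9 e2.
(* If |(T - p) v1| <= dl = d / c, the coefficients of (T - p)^* (T - p) are at most
   dl * 3 * |v2| <= d. *)
pose c := 3 * (\sum_(v <- s) nrm v.2 + 1).
have sum0 (f : H * H -> H) : 0 <= \sum_(v <- s) nrm (f v).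
  by apply: sumr_ge0 => v _; exact: nrm_ge0.
have sum_le (f : H * H -> H) v : v \in s -> nrm (f v) <= \sum_(v <- s) nrm (f v).
  move=> vs; rewrite (big_rem v vs) /= lerDl; apply: sumr_ge0 => w _; exact: nrm_ge0.
have c0 : 0 < c by rewrite mulr_gt0// ltr_wpDl.
pose dl := d / c; have dl0 : 0 < dl by rewrite divr_gt0.
have xwot : wot_closure [set S | exists T, joint_alg X Y S T] x.
  apply: M_min => // [|i]; first exact: wot_closure_vna joint_star_algebra.
  by apply: wot_closure_sub; exists (Y i); exact: joint_gen.
have dl4 : 0 < dl / 4 by rewrite divr_gt0.
have [p [[q0 pq0] p_sa px]] := strong_self_adjoint
  ([seq hx v.1 | v <- s] ++ [seq x (hx v.1) | v <- s]) joint_star_algebra x_sa xwot dl4.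
have [q q_sa pq] := joint_self_adjoint p_sa pq0.
have [rp rp0 pr] := bounded_by_ex p; have [rq rq0 qr] := bounded_by_ex q.
pose r := rp + rq; have r0 : 0 < r by rewrite addr_gt0.
have {}pr : bounded_by r p by apply: bounded_by_le pr; rewrite lerDl ltW.
have {}qr : bounded_by r q by apply: bounded_by_le qr; rewrite lerDr ltW.
have [hp [up hp1 hp2]] := neumann_cvg (ltW r0) p_sa pr.
have [hq [uq hq1 hq2]] := neumann_cvg (ltW r0) q_sa qr.
have [hpb phpb] := resolvent_bounded p_sa hp1.
have [hqb qhqb] := resolvent_bounded q_sa hq1.
pose c1 := \sum_(v <- s) nrm v.1 + 1; have c10 : 0 < c1 by rewrite ltr_wpDl.
(* The two bounds ensure norm at most 2 and an error of at most dl / 2 at the v1. *)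
pose eta := Num.min 1 (dl / 2 / c1); have eta0 : 0 < eta by rewrite lt_min ltr01 !divr_gt0.
have [|lp upl] := up (eta / r); first by rewrite divr_gt0.
have [|lq uql] := uq (eta / r); first by rewrite divr_gt0.
pose l := maxn lp lq.
pose P := p * neumann (1 + r ^+ 2) p l; pose Q := q * neumann (1 + r ^+ 2) q l.
have rE : r * (eta / r) = eta by rewrite mulrC divfK// gt_eqF.
have Pd : bounded_by eta (p * hp - P).
  by rewrite -mulrBr -rE; apply: bounded_byM => //; [exact: ltW|apply: upl; exact: leq_maxl].
have Qd : bounded_by eta (q * hq - Q).
  by rewrite -mulrBr -rE; apply: bounded_byM => //; [exact: ltW|apply: uql; exact: leq_maxr].
have eta1 : eta <= 1 by rewrite ge_min lexx.
have bd2 (L : hilbertType R) (a b : bop L) : bounded_by 1 a -> bounded_by eta (a - b) -> bounded_by 2 b.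
  move=> a1 ab; have -> : b = a - (a - b) by rewrite opprB addrC subrK.
  have -> : 2 = 1 + 1 :> R by [].
  by apply: bounded_byB => //; exact: bounded_by_le ab.
have P2 : bounded_by 2 P by exact: bd2 phpb Pd.
have JPQ : joint_alg X Y P Q by apply: joint_mul => //; exact: joint_neumann.
exists P, Q; split => //; first exact: bd2 qhqb Qd.
have MP : M P by exact: joint_mem JPQ.
pose S := T - P; have MS : M S by exact: vnaB.
have S3 : bounded_by 3 S.
  have : bounded_by (1/4 + 2) S by exact: bounded_byB.
  by apply: bounded_by_le; lra.
have Ssmall v : v \in s -> nrm (S v.1) <= dl.
  move=> vs.
  have SE : S = (p * hp - P) - (p * hp - x * hx) by rewrite /S TE opprB [RHS]addrC addrA subrK.
  rewrite SE bopBE; apply: le_trans (nrm_triangle _ _) _; rewrite nrmN.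
  have h1 : nrm ((p * hp - P) v.1) <= dl / 2.
    apply: le_trans (Pd v.1) _.
    have h : eta <= dl / 2 / c1 by rewrite ge_min lexx orbT.
    apply: le_trans (ler_wpM2r (nrm_ge0 _) h) _.
    rewrite mulrAC ler_pdivrMr// ler_pM2l ?divr_gt0// /c1.
    by apply: le_trans (sum_le fst v vs) _; rewrite lerDl.
  have h2 : nrm ((p * hp - x * hx) v.1) <= dl / 4 + dl / 4.
    rewrite (resolvent_diff hp2 hp1 hx1) bopBE; apply: le_trans (nrm_triangle _ _) _.
    rewrite nrmN; apply: lerD.
      rewrite bopME; apply: le_trans (hpb _) _; rewrite mul1r bopME bopBE; apply/ltW/px.
      by rewrite mem_cat; apply/orP; left; apply/mapP; exists v.
    rewrite bopME; apply: le_trans (phpb _) _; rewrite mul1r !bopME bopBE; apply/ltW/px.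
    by rewrite mem_cat; apply/orP; right; apply/mapP; exists v.
  by apply: le_trans (lerD h1 h2) _; lra.
have MSS : M (adj S * S) by apply: vna_mul => //; exact: vna_adj.
have : nrm (tau (adj S * S)) < e ^+ 2.
  apply: small => //.
    have -> : 9 = 3 * 3 :> R by lra.
    by apply: bounded_byM => //; apply: bounded_by_adj.
  move=> v vs; rewrite bopME adjPl; apply: le_trans (nrm_inner _ _) _.
  apply: le_trans (ler_wpM2r (nrm_ge0 _) (Ssmall v vs)) _.
  apply: le_trans (ler_wpM2l (ltW dl0) (S3 v.2)) _.
  rewrite /dl mulrAC ler_pdivrMr// ler_pM2l// /c ler_pM2l//.
  by apply: le_trans (sum_le snd v vs) _; rewrite lerDl.
rewrite (sq_norm2E tauS)// nrm_real ger0_norm ?(sq_norm2_ge0 tauS)// -(norm2_sq tauS)//.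
by rewrite ltr_sqr// ?nnegrE ?norm2_ge0// ltW.
Qed.

End JointAlgebra.

(** * Completeness of bounded sets for the 2-norm *)

Section UltraLimits.
Context {R : realType} {U : set_system nat} {UU : UltraFilter U}.

Definition ultra_lim (f : nat -> R[i]) (l : R[i]) :=
  forall e : R, 0 < e -> U [set n | nrm (f n - l) < e].

(** A cluster point in the compact interval is a limit, because the ultrafilter contains
    either the preimage of a ball around it or the complement of that preimage. *)
Lemma ultra_lim_real (f : nat -> R) (C : R) : (forall n, `|f n| <= C) ->
  exists l : R, forall e : R, 0 < e -> U [set n | `|f n - l| < e].
Proof.
move=> fC; have fU : U (f @^-1` `[- C, C]%classic).
  apply: filterS filterT => n _; rewrite /preimage /= in_itv /= -ler_norml; exact: fC.
have [l [_ cl]] := @segment_compact _ (- C) C (f @ U) _ fU; exists l => e e0.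
have [//|Un] := in_ultra_setVsetC [set n | `|f n - l| < e] UU.
have [y [ny ly]] := cl [set y | ~ `|y - l| < e] (ball l e) Un (nbhsx_ballx l e e0).
by exfalso; apply: ny; move: ly; rewrite -ball_normE /ball_ /= distrC.
Qed.

Lemma ultra_lim_ex (f : nat -> R[i]) (C : R) : (forall n, nrm (f n) <= C) ->
  exists l, ultra_lim f l.
Proof.
move=> fC.
have [a fa] := @ultra_lim_real (fun n => complex.Re (f n)) C
  (fun n => le_trans (normRe_le _) (fC n)).
have [b fb] := @ultra_lim_real (fun n => complex.Im (f n)) C
  (fun n => le_trans (normIm_le _) (fC n)).
exists (a +i* b) => e e0; have e2 : 0 < e / 2 by rewrite divr_gt0.
apply: filterS (filterI (fa _ e2) (fb _ e2)) => n [/= na nb].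
apply: le_lt_trans (nrm_le_ReIm _) _; rewrite (splitr e).
by move: na nb; case: (f n) => u v /=; exact: ltrD.
Qed.

Lemma ultra_lim_unique f l l' : ultra_lim f l -> ultra_lim f l' -> l = l'.
Proof.
move=> fl fl'; apply/eqP; rewrite -subr_eq0; apply/eqP/nrm_eq0/eqP.
rewrite eq_le nrm_ge0 andbT; apply/ler_addgt0Pr => e e0; rewrite add0r.
have e2 : 0 < e / 2 by rewrite divr_gt0.
have [n [/= nl nl']] := filter_ex (filterI (fl _ e2) (fl' _ e2)).
apply: le_trans (nrm_dist (f n) _ _) _; rewrite nrm_distC (splitr e).
by apply/ltW/ltrD.
Qed.

Lemma ultra_lim_lin (a : R[i]) f g l m : ultra_lim f l -> ultra_lim g m ->
  ultra_lim (fun n => a * f n + g n) (a * l + m).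
Proof.
move=> fl gm e e0; have a1 : 0 < nrm a + 1 by rewrite ltr_wpDl ?nrm_ge0.
have e2 : 0 < e / 2 by rewrite divr_gt0.
have e3 : 0 < e / 2 / (nrm a + 1) by rewrite divr_gt0.
apply: filterS (filterI (fl _ e3) (gm _ e2)) => n [/= nl nm].
rewrite opprD addrACA -mulrBr; apply: le_lt_trans (nrm_triangle _ _) _.
rewrite nrmM (splitr e); apply: ler_ltD => //.
move: nl; rewrite ltr_pdivlMr// => /ltW; apply: le_trans.
by rewrite mulrC ler_wpM2l ?nrm_ge0// lerDl.
Qed.

Lemma ultra_lim_conj f l : ultra_lim f l ->
  ultra_lim (fun n => ((f n)^*)%R) ((l^*)%R).
Proof.
by move=> fl e /fl; apply: filterS => n /=; rewrite -rmorphB nrm_conj.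
Qed.

Lemma ultra_lim_bounded f l (C : R) : (forall n, nrm (f n) <= C) -> ultra_lim f l -> nrm l <= C.
Proof.
move=> fC fl; apply/ler_addgt0Pr => e /fl /filter_ex[n /= nl].
rewrite -(subrK (f n) l) addrC; apply: le_trans (nrm_triangle _ _) _.
by apply: lerD => //; rewrite nrm_distC ltW.
Qed.

Lemma ultra_all (T : eqType) (s : seq T) (P : T -> set nat) :
  (forall v, v \in s -> U (P v)) -> U [set n | forall v, v \in s -> P v n].
Proof.
elim: s => [|w s IHs] sP; first by apply: filterS filterT.
have Us : U [set n | forall v, v \in s -> P v n].
  by apply: IHs => v vs; apply: sP; rewrite inE vs orbT.
have Uw : U (P w) by apply: sP; rewrite mem_head.
apply: filterS (filterI Uw Us) => n [/= nw ns] v.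
by rewrite inE => /predU1P[->//|]; exact: ns.
Qed.

Context {K : hilbertType R}.

(** Weak compactness of balls: the limit of the matrix coefficients along the
    ultrafilter is a bounded sesquilinear form, hence given by an operator. *)
Lemma ultra_weak_limit (q : nat -> bop K) r : 0 <= r -> (forall n, bounded_by r (q n)) ->
  exists2 T, bounded_by r T & forall x y, ultra_lim (fun n => inner (q n x) y) (inner (T x) y).
Proof.
move=> r0 qr.
have qxy x y n : nrm (inner (q n x) y) <= r * nrm x * nrm y.
  apply: le_trans (nrm_inner _ _) _; rewrite ler_wpM2r ?nrm_ge0//; exact: qr.
have /choice[L Lq] (v : K * K) : exists l, ultra_lim (fun n => inner (q n v.1) v.2) l.
  by apply: ultra_lim_ex => n; exact: qxy.
have Lb x y : nrm (L (x, y)) <= r * nrm x * nrm y.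
  by apply: ultra_lim_bounded (Lq (x, y)) => n; exact: qxy.
have /choice[g gL] x : exists u, forall y, ((L (x, y))^*)%R = inner y u.
  apply: riesz => [a y z|].
    apply: ultra_lim_unique (ultra_lim_conj (Lq (x, a *: y + z))) _.
    have := ultra_lim_lin a (ultra_lim_conj (Lq (x, y))) (ultra_lim_conj (Lq (x, z))).
    congr (ultra_lim _ _); apply/funext => n /=.
    by rewrite -!innerC innerDl innerZl.
  exists (r * nrm x)%:C => y; rewrite !nrmE -rmorphM lecR nrm_conj; exact: Lb.
have gE x y : inner (g x) y = L (x, y) by rewrite innerC -gL conjCK.
have gl : linear g.
  move=> a x z; apply: inner_ext => y.
  apply: (can_inj conjCK); rewrite -!innerC innerDl innerZl !gE.
  apply: ultra_lim_unique (Lq (a *: x + z, y)) _.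
  have := ultra_lim_lin a (Lq (x, y)) (Lq (z, y)).
  by congr (ultra_lim _ _); apply/funext => n /=; rewrite bop_linear innerDl innerZl.
have gb x : nrm (g x) <= r * nrm x.
  apply: le_of_sq_le; first by rewrite mulr_ge0 ?nrm_ge0.
  apply: le_trans (Lb x (g x)); rewrite -gE innerxx nrm_real expr2.
  exact: ler_norm.
have [T Tg] := bop_of_bounded gl gb; exists T => [x|x y]; rewrite Tg//.
by rewrite gE; exact: (Lq (x, y)).
Qed.

End UltraLimits.

(** A weak cluster point T of a bounded 2-norm Cauchy sequence is its limit: in
    |T - q_l|^2 = chi((T - q_l)^* (T - q_m)) + chi((T - q_l)^* (q_m - q_l))
    the first term tends to 0 along the ultrafilter by normality, and the second is at
    most |T - q_l| |q_m - q_l|. *)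
Lemma norm2_complete (R : realType) (K : hilbertType R) (N : set (bop K))
    (chi : bop K -> R[i]) (q : nat -> bop K) (r : R) :
  von_neumann_algebra N -> state_on N chi -> normal_on N chi -> 0 < r ->
  (forall n, N (q n)) -> (forall n, bounded_by r (q n)) ->
  (forall e : R, 0 < e -> exists n, forall l m, (n <= l)%N -> (n <= m)%N ->
    norm2 chi (q l - q m) <= e) ->
  exists2 T, N T & forall e : R, 0 < e ->
    exists n, forall l, (n <= l)%N -> norm2 chi (T - q l) <= e.
Proof.
move=> vN chiS chiN r0 Nq qr qC.
have [U [UU Uoo]] := ultraFilterLemma (eventually_filter).
have [T Tr qT] := ultra_weak_limit (U := U) (ltW r0) qr.
have NT : N T.
  apply: (vna_wot_closed vN); apply/wot_closureP => s e e0.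
  have : U [set n | forall v, v \in s -> nrm (inner (q n v.1 - T v.1) v.2) < e].
    apply: ultra_all => v _; have := qT v.1 v.2 e e0.
    by apply: filterS => n /=; rewrite innerBl.
  by move=> /filter_ex[n /= sn]; exists (q n).
exists T => // e e0; have [n nP] := qC e e0; exists n => l nl.
pose D := T - q l; have ND : N D by exact: vnaB.
have D2 : bounded_by (r + r) D by exact: bounded_byB.
have NDa : N (adj D) by exact: vna_adj.
suff : norm2 chi D * norm2 chi D <= e * norm2 chi D.
  by apply: le_of_sq_le; exact: ltW.
rewrite -expr2 (norm2_sq chiS)//; apply/ler_addgt0Pr => eta eta0.
have rr : 0 <= (r + r) * (r + r) by rewrite mulr_ge0// addr_ge0// ltW.
have [s [d [d0 small]]] := normal_on_bounded vN chiS chiN rr eta0.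
have Us : U [set m | forall v, v \in s -> nrm (inner (T v.1 - q m v.1) (D v.2)) < d].
  apply: ultra_all => v _; have := qT v.1 (D v.2) d d0.
  by apply: filterS => m /=; rewrite innerBl nrm_distC.
have Un : U [set m | (n <= m)%N] by apply: Uoo; exists n.
have [m [/= sm nm]] := filter_ex (filterI Us Un).
have Tm : N (T - q m) by exact: vnaB.
have qml : N (q m - q l) by exact: vnaB.
have DE : adj D * D = adj D * (T - q m) + adj D * (q m - q l).
  by rewrite -mulrDr addrA subrK.
rewrite /sq_norm2 DE (stateD chiS); [|exact: vna_mul|exact: vna_mul].
apply: le_trans (ler_norm _) _; apply: le_trans (normRe_le _) _.
apply: le_trans (nrm_triangle _ _) _; rewrite addrC; apply: lerD; last first.
  apply/ltW/small; first exact: vna_mul.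
    apply: bounded_byM; first by rewrite addr_ge0// ltW.
      by apply: bounded_by_adj => //; rewrite addr_ge0// ltW.
    exact: bounded_byB.
  by move=> v vs; rewrite bopME adjPl bopBE; apply/ltW/sm.
apply: le_trans (norm2_inner vN chiS qml ND) _.
rewrite mulrC ler_wpM2r ?norm2_ge0//; exact: nP.
Qed.

(** * The isomorphism determined by equal moments *)

Section Graph.
Context {R : realType} {H K : hilbertType R} {I : Type}.
Context (X : I -> bop H) (Y : I -> bop K).
Context (M : set (bop H)) (N : set (bop K)).
Context (tau : bop H -> R[i]) (chi : bop K -> R[i]).

(** The graph of the isomorphism.  The uniform bound r makes it closed under products,
    as the 2-norm is submultiplicative only against operator norms. *)
Definition moment_graph S T := [/\ M S, N T & exists2 r : R, 0 < r &
  forall e : R, 0 < e -> exists p q, [/\ joint_alg X Y p q,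
    bounded_by r p, bounded_by r q, norm2 tau (S - p) <= e & norm2 chi (T - q) <= e]].

End Graph.

Section GraphTheory.
Context {R : realType} {H K : hilbertType R} {I : Type}.
Context {X : I -> bop H} {Y : I -> bop K}.
Context {M : set (bop H)} {N : set (bop K)}.
Context {tau : bop H -> R[i]} {chi : bop K -> R[i]}.
Hypothesis X_sa : forall i, self_adjoint (X i).
Hypothesis Y_sa : forall i, self_adjoint (Y i).
Hypothesis M_gen : vna_generated_by X M.
Hypothesis N_gen : vna_generated_by Y N.
Hypothesis tauP : normal_faithful_tracial_state M tau.
Hypothesis chiP : normal_faithful_tracial_state N chi.
Hypothesis same_moments : forall S T, joint_alg X Y S T -> tau S = chi T.

Local Notation graph := (moment_graph X Y M N tau chi).
Let vM : von_neumann_algebra M. Proof. by case: M_gen. Qed.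
Let vN : von_neumann_algebra N. Proof. by case: N_gen. Qed.
Let MX i : M (X i). Proof. by case: M_gen. Qed.
Let NY i : N (Y i). Proof. by case: N_gen. Qed.
Let tauS := nft_state tauP.
Let chiS := nft_state chiP.
Let tauT := nft_tracial tauP.
Let chiT := nft_tracial chiP.

Let joint_fst p q : joint_alg X Y p q -> M p.
Proof. exact: joint_mem. Qed.
Let joint_snd p q : joint_alg X Y p q -> N q.
Proof. by move/joint_sym; exact: joint_mem. Qed.

Lemma joint_norm2 p q : joint_alg X Y p q -> norm2 tau p = norm2 chi q.
Proof.
move=> pq; congr (Num.sqrt (complex.Re _)); apply: same_moments.
by apply: joint_mul => //; exact: joint_adj.
Qed.

Lemma graph_joint p q : joint_alg X Y p q -> graph p q.
Proof.
move=> pq; split; [exact: joint_fst pq|exact: joint_snd pq|].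
have [r r0 pr] := bounded_by_ex p; have [s s0 qs] := bounded_by_ex q.
exists (r + s); first exact: addr_gt0.
move=> e e0; exists p, q; split => //.
- by apply: bounded_by_le pr; rewrite lerDl ltW.
- by apply: bounded_by_le qs; rewrite lerDr ltW.
- by rewrite subrr /norm2 /sq_norm2 mulr0 (state0 vM tauS) sqrtr0 ltW.
- by rewrite subrr /norm2 /sq_norm2 mulr0 (state0 vN chiS) sqrtr0 ltW.
Qed.

Let norm2_lin_le (L : hilbertType R) (A : set (bop L)) sigma (a : R[i]) S T p q e :
  von_neumann_algebra A -> state_on A sigma -> A S -> A T -> A p -> A q -> 0 < e ->
  norm2 sigma (S - p) <= e / (nrm a + 1) -> norm2 sigma (T - q) <= e / (nrm a + 1) ->
  norm2 sigma (a *: S + T - (a *: p + q)) <= e.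
Proof.
move=> vA sS AS AT Ap Aq e0 Sp Tq.
have a1 : 0 < nrm a + 1 by rewrite ltr_wpDl ?nrm_ge0.
have ASp : A (S - p) by exact: vnaB.
have ATq : A (T - q) by exact: vnaB.
rewrite opprD addrACA -scalerBr; apply: le_trans (norm2_triangle vA sS _ ATq) _.
  exact: vnaZ.
rewrite (norm2Z vA sS)//.
apply: le_trans (lerD (ler_wpM2l (nrm_ge0 a) Sp) Tq) _.
by rewrite -[X in _ + X]mul1r -mulrDl mulrC divfK// gt_eqF.
Qed.

Lemma graph_lin (a : R[i]) S S' T T' :
  graph S S' -> graph T T' -> graph (a *: S + T) (a *: S' + T').
Proof.
move=> [MS NS [r r0 rP]] [MT NT [s s0 sP]].
split; [exact: vna_linear|exact: vna_linear|].
have a1 : 0 < nrm a + 1 by rewrite ltr_wpDl ?nrm_ge0.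
exists (nrm a * r + s); first by rewrite ltr_wpDl// mulr_ge0 ?nrm_ge0// ltW.
move=> e e0; have e1 : 0 < e / (nrm a + 1) by rewrite divr_gt0.
have [p [p' [pp pr p'r Sp Sp']]] := rP _ e1.
have [q [q' [qq qs q's Tq Tq']]] := sP _ e1.
exists (a *: p + q), (a *: p' + q'); split.
- exact: joint_lin.
- by apply: bounded_byD => //; exact: bounded_byZ.
- by apply: bounded_byD => //; exact: bounded_byZ.
- by apply: norm2_lin_le vM _ _ _ _ _ e0 Sp Tq => //; [exact: joint_fst pp|exact: joint_fst qq].
- by apply: norm2_lin_le vN _ _ _ _ _ e0 Sp' Tq' => //; [exact: joint_snd pp|exact: joint_snd qq].
Qed.

Lemma graph_adj S T : graph S T -> graph (adj S) (adj T).
Proof.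
move=> [MS NT [r r0 rP]]; split; [exact: vna_adj|exact: vna_adj|].
exists r => // e /rP[p [q [pq pr qr Sp Tq]]]; exists (adj p), (adj q).
have Mp := joint_fst pq; have Nq := joint_snd pq; split.
- exact: joint_adj.
- by apply: bounded_by_adj => //; exact: ltW.
- by apply: bounded_by_adj => //; exact: ltW.
- by rewrite -adjB (norm2_adj vM tauT)//; exact: vnaB.
- by rewrite -adjB (norm2_adj vN chiT)//; exact: vnaB.
Qed.

Let norm2_mul_le (L : hilbertType R) (A : set (bop L)) sigma S T p q (r s e : R) :
  von_neumann_algebra A -> state_on A sigma -> tracial_on A sigma ->
  A S -> A T -> A p -> A q -> 0 < r -> 0 < s -> 0 < e ->
  bounded_by r S -> bounded_by s q ->
  norm2 sigma (S - p) <= e / (2 * (r + s)) -> norm2 sigma (T - q) <= e / (2 * (r + s)) ->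
  norm2 sigma (S * T - p * q) <= e.
Proof.
move=> vA sS sT AS AT Ap Aq r0 s0 e0 Sr qs Sp Tq.
have ASp : A (S - p) by exact: vnaB.
have ATq : A (T - q) by exact: vnaB.
have -> : S * T - p * q = S * (T - q) + (S - p) * q.
  by rewrite mulrBr mulrBl addrA subrK.
have AS1 : A (S * (T - q)) by exact: vna_mul.
have AS2 : A ((S - p) * q) by exact: vna_mul.
apply: le_trans (norm2_triangle vA sS AS1 AS2) _.
have h1 := norm2_mull vA sS AS ATq r0 Sr.
have h2 := norm2_mulr vA sS sT Aq ASp s0 qs.
apply: le_trans (lerD h1 h2) _.
have r2 : 0 <= 2 * r by rewrite mulr_ge0// ltW.
have s2 : 0 <= 2 * s by rewrite mulr_ge0// ltW.
apply: le_trans (lerD (ler_wpM2l r2 Tq) (ler_wpM2l s2 Sp)) _.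
by rewrite -mulrDl -mulrDr mulrC divfK// gt_eqF// mulr_gt0// addr_gt0.
Qed.

Lemma graph_mul S S' T T' : graph S S' -> graph T T' -> graph (S * T) (S' * T').
Proof.
move=> [MS NS [r r0 rP]] [MT NT [s s0 sP]].
split; [exact: vna_mul|exact: vna_mul|].
have [u u0 Su] := bounded_by_ex S; have [v v0 Sv] := bounded_by_ex S'.
have uv0 : 0 < u + v by exact: addr_gt0.
have {}Su : bounded_by (u + v) S by apply: bounded_by_le Su; rewrite lerDl ltW.
have {}Sv : bounded_by (u + v) S' by apply: bounded_by_le Sv; rewrite lerDr ltW.
exists (r * s); first exact: mulr_gt0.
move=> e e0; have e1 : 0 < e / (2 * (u + v + s)).
  by rewrite divr_gt0// mulr_gt0// addr_gt0.
have [p [p' [pp pr p'r Sp Sp']]] := rP _ e1.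
have [q [q' [qq qs q's Tq Tq']]] := sP _ e1.
exists (p * q), (p' * q'); split.
- exact: joint_mul.
- by apply: bounded_byM => //; exact: ltW.
- by apply: bounded_byM => //; exact: ltW.
- by apply: (norm2_mul_le vM tauS tauT MS MT (joint_fst pp) (joint_fst qq) uv0 s0 e0).
- by apply: (norm2_mul_le vN chiS chiT NS NT (joint_snd pp) (joint_snd qq) uv0 s0 e0).
Qed.

Lemma graph_trace S T : graph S T -> tau S = chi T.
Proof.
move=> [MS NT [r r0 rP]]; apply/eqP; rewrite -subr_eq0; apply/eqP/nrm_eq0/eqP.
rewrite eq_le nrm_ge0 andbT; apply/ler_addgt0Pr => e e0; rewrite add0r.
have e2 : 0 < e / 2 by rewrite divr_gt0.
have [p [q [pq _ _ Sp Tq]]] := rP _ e2.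
have Mp := joint_fst pq; have Nq := joint_snd pq.
apply: le_trans (nrm_dist (tau p) _ _) _; rewrite {2}(same_moments pq) (nrm_distC (chi q)).
rewrite -(stateB vM tauS)// -(stateB vN chiS)// (splitr e); apply: lerD.
  by apply: le_trans (nrm_state vM tauS _) Sp; exact: vnaB.
by apply: le_trans (nrm_state vN chiS _) Tq; exact: vnaB.
Qed.

Lemma graph_norm2 S T : graph S T -> norm2 tau S = norm2 chi T.
Proof.
move=> ST; congr (Num.sqrt (complex.Re _)); apply: graph_trace.
by apply: graph_mul => //; exact: graph_adj.
Qed.

Lemma graph_sub S S' T T' : graph S S' -> graph T T' -> graph (S - T) (S' - T').
Proof.
by move=> SS TT; have := graph_lin (-1) TT SS; rewrite !scaleN1r !(addrC (- _)).
Qed.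

(** The difference of two values is related to 0, so its 2-norm is 0. *)
Lemma graph_functional S T T' : graph S T -> graph S T' -> T = T'.
Proof.
move=> ST ST'; apply/eqP; rewrite -subr_eq0; apply/eqP.
have NT : N (T - T') by case: ST ST' => _ NT _ [_ NT' _]; exact: vnaB.
apply: (norm2_eq0 chiS (nft_faithful chiP)) => //.
rewrite -(graph_norm2 (graph_sub ST ST')) subrr.
by rewrite /norm2 /sq_norm2 mulr0 (state0 vM tauS) sqrtr0.
Qed.

(** The first entries of the approximating pairs are Cauchy in the 2-norm of tau, hence
    so are the second ones in that of chi, because 2-norms of polynomials agree. *)
Lemma graph_total_quarter T : M T -> self_adjoint T -> bounded_by (1/4) T ->
  exists T', graph T T'.
Proof.
move=> MT T_sa T4.
have /choice[w wP] (n : nat) : exists v : bop H * bop K, [/\ joint_alg X Y v.1 v.2,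
    bounded_by 2 v.1, bounded_by 2 v.2 & norm2 tau (T - v.1) < n.+1%:R^-1].
  have n0 : 0 < n.+1%:R^-1 :> R by rewrite invr_gt0.
  have [p [q pq]] := simultaneous_kaplansky X_sa Y_sa M_gen tauP MT T_sa T4 n0.
  by exists (p, q).
have small (e : R) : 0 < e -> exists n, forall l, (n <= l)%N -> norm2 tau (T - (w l).1) <= e.
  move=> e0; have [k] := ltr_add_invr e0; rewrite add0r => ke.
  exists k => l kl; have [_ _ _ /ltW/le_trans] := wP l; apply.
  by apply: le_trans (ltW ke); rewrite lef_pV2 ?posrE// ler_nat.
have Mw l : M (w l).1 by case: (wP l) => /joint_fst.
have [||||T' NT' T'P] := norm2_complete (q := fun n => (w n).2) (r := 2) vN chiS (nft_normal chiP).
- by [].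
- by move=> n; case: (wP n) => /joint_snd.
- by move=> n; case: (wP n).
- move=> e e0; have e2 : 0 < e / 2 by rewrite divr_gt0.
  have [n nP] := small _ e2; exists n => l m nl nm.
  have wlm : joint_alg X Y ((w l).1 - (w m).1) ((w l).2 - (w m).2).
    by apply: joint_sub; [case: (wP l)|case: (wP m)].
  rewrite -(joint_norm2 wlm).
  have -> : (w l).1 - (w m).1 = (T - (w m).1) - (T - (w l).1).
    by rewrite opprB [RHS]addrC addrA subrK.
  apply: le_trans (norm2B vM tauS _ _) _; [exact: vnaB|exact: vnaB|].
  by rewrite (splitr e) lerD// nP.
exists T'; split => //; exists 2 => // e e0.
have [n nP] := small e e0; have [m mP] := T'P e e0.
have [wj w1 w2 _] := wP (maxn n m).
exists (w (maxn n m)).1, (w (maxn n m)).2; split => //.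
  by apply: nP; exact: leq_maxl.
by apply: mP; exact: leq_maxr.
Qed.

Lemma graph_scale (a : R[i]) S T : graph S T -> graph (a *: S) (a *: T).
Proof.
by move=> ST; have := graph_lin a ST (graph_joint (joint0 (X := X) (Y := Y))); rewrite !addr0.
Qed.

Lemma graph_total_self_adjoint T : M T -> self_adjoint T -> exists T', graph T T'.
Proof.
move=> MT T_sa; have [r r0 Tr] := bounded_by_ex T.
have c0 : 0 < 4 * r by rewrite mulr_gt0.
pose c := (4 * r)^-1.
have [|||T' TT'] := @graph_total_quarter (c%:C *: T).
- exact: vnaZ.
- by rewrite /self_adjoint adjZ conj_real T_sa.
- have -> : 1/4 = nrm c%:C * r :> R.
    rewrite nrm_real ger0_norm ?invr_ge0 ?(ltW c0)// /c; field.
    by rewrite gt_eqF.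
  exact: bounded_byZ.
exists ((4 * r)%:C *: T'); have := graph_scale (4 * r)%:C TT'.
by rewrite scalerA -rmorphM mulfV ?gt_eqF// scale1r.
Qed.

Lemma graph_total T : M T -> exists T', graph T T'.
Proof.
move=> MT; have MT' := vna_adj vM MT.
have i2 : (('i : R[i])^*)%R = - 'i by apply/eqP; rewrite eq_complex /= oppr0 !eqxx.
have [||A' AA'] := @graph_total_self_adjoint (T + adj T).
- exact: vnaD.
- by rewrite /self_adjoint adjD adjK addrC.
have [||B' BB'] := @graph_total_self_adjoint ('i *: (T - adj T)).
- by apply: vnaZ => //; exact: vnaB.
- by rewrite /self_adjoint adjZ adjB adjK i2 scaleNr -scalerN opprB.
exists ((2^-1 : R)%:C *: (- 'i *: B' + A')).
have := graph_scale (2^-1 : R)%:C (graph_lin (- 'i) BB' AA').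
rewrite scalerA mulNr -expr2 sqr_i opprK scale1r addrACA addNr addr0.
have hh : (2^-1 : R)%:C + (2^-1 : R)%:C = 1 by rewrite -rmorphD; congr (_%:C); lra.
by rewrite scalerDr -scalerDl hh scale1r.
Qed.

End GraphTheory.

Lemma graph_sym (R : realType) (H K : hilbertType R) (I : Type)
    (X : I -> bop H) (Y : I -> bop K) M N tau chi S T :
  moment_graph X Y M N tau chi S T -> moment_graph Y X N M chi tau T S.
Proof.
move=> [MS NT [r r0 rP]]; split => //; exists r => // e /rP[p [q [pq pr qr Sp Tq]]].
by exists q, p; split => //; exact: joint_sym.
Qed.

Lemma isomorphism_of_moments (R : realType) (H K : hilbertType R) (I : Type)
    (X : I -> bop H) (Y : I -> bop K) (M : set (bop H)) (N : set (bop K))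
    (tau : bop H -> R[i]) (chi : bop K -> R[i]) :
  (forall i, self_adjoint (X i)) -> (forall i, self_adjoint (Y i)) ->
  vna_generated_by X M -> vna_generated_by Y N ->
  normal_faithful_tracial_state M tau -> normal_faithful_tracial_state N chi ->
  (forall S T, joint_alg X Y S T -> tau S = chi T) ->
  exists phi : bop H -> bop K, [/\ star_isomorphism M N phi,
    forall i, phi (X i) = Y i & forall T, M T -> chi (phi T) = tau T].
Proof.
move=> X_sa Y_sa M_gen N_gen tauP chiP moments.
have moments' S T : joint_alg Y X S T -> chi S = tau T by move=> /joint_sym/moments.
have [vM MX _] := M_gen; have [vN NY _] := N_gen.
pose graph := moment_graph X Y M N tau chi.
have fE S T T' : graph S T -> graph S T' -> T = T'.
  exact: (graph_functional X_sa Y_sa M_gen N_gen tauP chiP moments).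
have fI S S' T : graph S T -> graph S' T -> S = S'.
  move=> /graph_sym ST /graph_sym ST'.
  exact: (graph_functional Y_sa X_sa N_gen M_gen chiP tauP moments') ST ST'.
have /choice[phi phiP] (S : bop H) : exists T, M S -> graph S T.
  have [MS|nMS] := pselect (M S); last by exists 0.
  by have [T ST] := graph_total X_sa Y_sa M_gen N_gen tauP chiP moments MS; exists T.
exists phi; split; first split.
- split.
  + by move=> S /= /phiP[].
  + by move=> S S' /set_mem MS /set_mem MS' e; apply: fI (phiP _ MS) _; rewrite e; exact: phiP.
  + move=> T NT; have [S /graph_sym ST] := graph_total Y_sa X_sa N_gen M_gen chiP tauP moments' NT.
    by case: (ST) => MS _ _; exists S => //; apply: fE ST; exact: phiP.
- move=> a S T MS MT; apply: fE (phiP _ _) _; first exact: vna_linear.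
  exact: (graph_lin M_gen N_gen tauP chiP) (phiP _ MS) (phiP _ MT).
- move=> S T MS MT; apply: fE (phiP _ _) _; first exact: vna_mul.
  exact: (graph_mul M_gen N_gen tauP chiP) (phiP _ MS) (phiP _ MT).
- apply: fE (phiP _ _) _; first exact: vna_one.
  exact: (graph_joint M_gen N_gen tauP chiP) (joint_one X Y).
- move=> T MT; apply: fE (phiP _ _) _; first exact: vna_adj.
  exact: (graph_adj X_sa Y_sa M_gen N_gen tauP chiP) (phiP _ MT).
- move=> i; apply: fE (phiP _ _) _; first exact: MX.
  exact: (graph_joint M_gen N_gen tauP chiP) (joint_gen X Y i).
- move=> T MT; symmetry.
  exact: (graph_trace M_gen N_gen tauP chiP moments) (phiP _ MT).
Qed.

(** * Equality of all noncommutative moments *)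

Section WordExpansion.
Context {C : comPzRingType}.
Implicit Types (n k : nat).

Lemma sum_tuple_cons (V : nmodType) (T : finType) p (F : p.+1.-tuple T -> V) :
  \sum_(w : p.+1.-tuple T) F w = \sum_(i : T) \sum_(w : p.-tuple T) F [tuple of i :: w].
Proof.
rewrite pair_big /= (reindex (fun v : T * p.-tuple T => [tuple of v.1 :: v.2])) //=.
exists (fun w => (thead w, [tuple of behead w])) => [[i w] _|w _] /=.
  by congr (_, _); apply/val_inj.
by rewrite [RHS]tuple_eta; apply/val_inj.
Qed.

Lemma sum_expn (S : pzSemiRingType) (T : finType) (f : T -> S) p :
  (\sum_i f i) ^+ p = \sum_(w : p.-tuple T) \prod_(i <- w) f i.
Proof.
elim: p => [|p IHp].
  rewrite expr0 (big_pred1 [tuple]) => [|w]; last by rewrite [w]tuple0 /= eqxx.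
  by rewrite big_nil.
rewrite exprS IHp sum_tuple_cons mulr_suml; apply: eq_bigr => i _.
by rewrite mulr_sumr; apply: eq_bigr => w _; rewrite big_cons.
Qed.

(** When D w = tau(X_w), this is the p-th moment of the sum of the a_i (x) X_i with
    respect to the unnormalized trace; see tens_trace_expn. *)
Definition word_trace {I : finType} (D : seq I -> C) p n (a : I -> 'M[C]_n) : C :=
  \sum_(w : p.-tuple I) \tr (\prod_(i <- w) a i) * D w.

Lemma prod_scale {I : finType} n (a : I -> 'M[C]_n) (t : C) (w : seq I) :
  \prod_(i <- w) (t *: a i) = t ^+ size w *: \prod_(i <- w) a i.
Proof.
elim: w => [|i w IHw]; first by rewrite !big_nil expr0 scale1r.
by rewrite !big_cons IHw exprS -!mulmxE -scalemxAl -scalemxAr scalerA.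
Qed.

Lemma word_trace_scale {I : finType} D p n (a : I -> 'M[C]_n) (t : C) :
  word_trace D p (fun i => t *: a i) = t ^+ p * word_trace D p a.
Proof.
rewrite /word_trace mulr_sumr; apply: eq_bigr => w _.
by rewrite prod_scale mxtraceZ size_tuple mulrA.
Qed.

End WordExpansion.

Section WordPolynomial.
Context {C : numFieldType} {I : finType}.
Implicit Types (n k : nat) (D : seq I -> C).

(** The polynomial is the word trace, formed over {poly C}, of the pencil a + X b. *)
Lemma word_trace_poly D p n (a b : I -> 'M[C]_n) :
  exists P : {poly C}, forall s, P.[s] = word_trace D p (fun i => a i + s *: b i).
Proof.
pose A i : 'M[{poly C}]_n := map_mx polyC (a i) + 'X *: map_mx polyC (b i).
exists (\sum_(w : p.-tuple I) \tr (\prod_(i <- w) A i) * (D w)%:P) => s.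
rewrite horner_sum; apply: eq_bigr => w _; rewrite hornerM hornerC; congr (_ * _).
rewrite -[LHS]/(horner_eval s _) -trace_map_mx; congr (\tr _).
elim: (tval w) => [|i u IHu]; first by rewrite !big_nil map_mx1.
rewrite !big_cons map_mxM IHu; congr (_ * _); apply/matrixP => x y.
by rewrite !mxE /= /horner_eval !hornerE.
Qed.

Lemma poly_nat_roots (P : {poly C}) (N : nat) :
  (forall m, (N <= m)%N -> P.[m%:R] = 0) -> P = 0.
Proof.
move=> P0; apply/eqP/negPn/negP => nP.
have := max_poly_roots nP (rs := [seq m%:R | m <- iota N (size P)]).
rewrite size_map size_iota ltnn => H; suff : false by []; apply: H.
  apply/allP => x /mapP[m]; rewrite mem_iota => /andP[Nm _] ->.
  by apply/rootP/P0.
rewrite map_inj_uniq ?iota_uniq// => x y /eqP.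
by rewrite eqr_nat => /eqP.
Qed.

Lemma word_trace_line D p n (a b : I -> 'M[C]_n) (N : nat) :
  (forall m, (N <= m)%N -> word_trace D p (fun i => a i + m%:R *: b i) = 0) ->
  forall s, word_trace D p (fun i => a i + s *: b i) = 0.
Proof.
move=> ab0 s; have [P PE] := word_trace_poly D p a b.
by rewrite -PE (@poly_nat_roots P N) ?horner0// => m /ab0; rewrite PE.
Qed.

End WordPolynomial.

Section Cycle.
Context {C : numFieldType} {I : finType}.
Implicit Types (D : seq I -> C).
Context {p : nat} (w : p.+1.-tuple I).

(** In the oriented cycle on p + 1 vertices the edge from r to r + 1 carries the letter
    w_r; this is the adjacency matrix of the edges carrying i. *)
Definition cycle_mx (i : I) : 'M[C]_p.+1 :=
  \matrix_(r, s) ((tnth w r == i) && (s == ordS r))%:R.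

Definition cycle_word (r : 'I_p.+1) (l : nat) : seq I :=
  [seq tnth w x | x <- traject (@ordS p.+1) r l].

(** The product of the matrices along a word counts the walks spelling that word, and
    there is at most one such walk from each vertex. *)
Lemma cycle_mx_prod u r s :
  (\prod_(i <- u) cycle_mx i) r s =
    ((cycle_word r (size u) == u) && (s == iter (size u) (@ordS _) r))%:R.
Proof.
elim: u r => [|i u IHu] r.
  by rewrite big_nil mxE /cycle_word /= (eq_sym s).
rewrite big_cons mxE (bigD1 (ordS r)) //= [X in _ + X]big1 ?addr0 => [|j jr].
  rewrite mxE eqxx andbT IHu /cycle_word /= eqseq_cons -iterS iterSr -natrM mulnb.
  by rewrite andbA.
by rewrite mxE (negPf jr) andbF mul0r.
Qed.

Lemma iter_ordS (r : 'I_p.+1) l : iter l (@ordS _) r = ((r + l) %% p.+1)%N :> nat.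
Proof.
elim: l => [|l IHl] /=; first by rewrite addn0 modn_small.
by rewrite IHl addnS -addn1 modnDml addn1.
Qed.

Lemma iter_ordS_period (r : 'I_p.+1) : iter p.+1 (@ordS _) r = r.
Proof. by apply/ord_inj; rewrite iter_ordS modnDr modn_small. Qed.

Lemma size_cycle_word r l : size (cycle_word r l) = l.
Proof. by rewrite size_map size_traject. Qed.

(** A closed walk of length p + 1 goes around the cycle exactly once. *)
Lemma word_trace_cycle D :
  word_trace D p.+1 cycle_mx = \sum_r D (cycle_word r p.+1).
Proof.
rewrite /word_trace /mxtrace.
under eq_bigr do rewrite mulr_suml.
rewrite exchange_big /=; apply: eq_bigr => r _.
have sz : size (cycle_word r p.+1) == p.+1 by rewrite size_cycle_word.
rewrite (bigD1 (Tuple sz)) //= [X in _ + X]big1 ?addr0 => [|u ur].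
  by rewrite cycle_mx_prod size_cycle_word eqxx iter_ordS_period eqxx mul1r.
rewrite cycle_mx_prod size_tuple; case: eqP => [e|_]; last by rewrite mul0r.
by case/negP: ur; apply/eqP/val_inj; rewrite /= e.
Qed.

Lemma cycle_word0 : cycle_word ord0 p.+1 = w.
Proof.
apply: (@eq_from_nth _ (tnth w ord0)); first by rewrite size_cycle_word size_tuple.
move=> l; rewrite size_cycle_word => lp.
rewrite (nth_map ord0) ?size_traject// nth_traject// (tnth_nth (tnth w ord0)).
by rewrite iter_ordS add0n modn_small.
Qed.

Lemma cyclic_cycle_word D : (forall i u, D (rcons u i) = D (i :: u)) ->
  forall r, D (cycle_word r p.+1) = D w.
Proof.
move=> Dcyc.
have step r : D (cycle_word (ordS r) p.+1) = D (cycle_word r p.+1).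
  rewrite {1}/cycle_word trajectSr map_rcons Dcyc -iterSr iter_ordS_period.
  by rewrite /cycle_word trajectS.
have H l : D (cycle_word (iter l (@ordS _) ord0) p.+1) = D w.
  by elim: l => [|l IHl]; [rewrite /= cycle_word0|rewrite iterS step].
move=> r; rewrite -(H r); congr (D (cycle_word _ _)); apply/ord_inj.
by rewrite iter_ordS add0n modn_small.
Qed.

Lemma word_trace_eq0 D : (forall i u, D (rcons u i) = D (i :: u)) ->
  (forall a : I -> 'M[C]_p.+1, word_trace D p.+1 a = 0) -> D w = 0.
Proof.
move=> Dcyc /(_ cycle_mx); rewrite word_trace_cycle.
under eq_bigr do rewrite (cyclic_cycle_word Dcyc).
by rewrite sumr_const card_ord -mulr_natl => /eqP; rewrite mulf_eq0 pnatr_eq0 => /eqP.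
Qed.

End Cycle.

Section HermitianSpectrum.
Context {R : realType}.
Implicit Types (n : nat).

Definition hermitian n (b : 'M[R[i]]_n) := forall r s, b r s = ((b s r)^*)%R.

Lemma hermitian_hermsymmx n (b : 'M[R[i]]_n) : hermitian b -> b \is hermsymmx.
Proof.
move=> bh; apply/is_hermitianmxP; rewrite expr0 scale1r; apply/matrixP => r s.
by rewrite !mxE.
Qed.

Definition entry_sum n (b : 'M[R[i]]_n) : R := \sum_r \sum_s nrm (b r s).

(** Reality follows from v b v^* = mu v v^*; summing |mu v_s| = |(v b)_s| over s gives
    the bound. *)
Lemma hermitian_eigenvalue n (b : 'M[R[i]]_n) (v : 'rV[R[i]]_n) mu :
  hermitian b -> v *m b = mu *: v -> v != 0 ->
  exists2 m : R, mu = m%:C & `|m| <= entry_sum b.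
Proof.
move=> bh vb v0.
have vbE s : \sum_r v 0 r * b r s = mu * v 0 s.
  by have /matrixP/(_ 0 s) := vb; rewrite !mxE.
have [j vj] : exists j, v 0 j != 0 by apply/rV0Pn.
have muR : mu \is Num.real.
  pose q := \sum_s v 0 s * ((v 0 s)^*)%R.
  have q0 : q != 0.
    rewrite /q psumr_neq0 => [|s _]; last by rewrite -normCK exprn_ge0.
    by apply/hasP; exists j; rewrite ?mem_index_enum//= -normCK exprn_gt0 ?normr_gt0.
  have qR : (q^*)%R = q.
    by rewrite rmorph_sum; apply: eq_bigr => s _; rewrite rmorphM /= conjCK mulrC.
  have muq : mu * q = \sum_s \sum_r v 0 r * b r s * ((v 0 s)^*)%R.
    by rewrite mulr_sumr; apply: eq_bigr => s _; rewrite mulrA -vbE mulr_suml.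
  have : (mu^*)%R * q = mu * q.
    rewrite -{1}qR -rmorphM muq rmorph_sum exchange_big /=; apply: eq_bigr => s _.
    rewrite rmorph_sum; apply: eq_bigr => r _.
    by rewrite !rmorphM /= conjCK -bh; ring.
  by move/(mulIf q0)/CrealP.
exists (complex.Re mu); first by rewrite RRe_real.
apply: le_trans (normRe_le _) _.
pose S := \sum_s nrm (v 0 s).
have nv s : 0 <= nrm (v 0 s) by exact: nrm_ge0.
have S0 : 0 < S.
  rewrite /S (bigD1 j)//= ltr_pwDl ?sumr_ge0// lt_neqAle nv andbT.
  by apply: contra vj => /eqP/esym/nrm_eq0 ->.
rewrite -(ler_pM2r S0) /S mulr_sumr.
under eq_bigr do rewrite -nrmM -vbE.
apply: (@le_trans _ _ (\sum_s \sum_r nrm (v 0 r) * nrm (b r s))).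
  apply: ler_sum => s _; apply: le_trans (nrm_sum _ _ _) _.
  by apply: ler_sum => r _; rewrite nrmM.
rewrite exchange_big /= mulr_sumr; apply: ler_sum => r _; rewrite -mulr_sumr.
rewrite mulrC ler_wpM2r// /entry_sum [leRHS](bigD1 r)//= lerDl.
by do 2 (apply: sumr_ge0 => ? _); exact: nrm_ge0.
Qed.

End HermitianSpectrum.

Section TensorMoments.
Context {R : realType} {H : hilbertType R} {I : finType}.
Context {M : set (bop H)} {tau : bop H -> R[i]} {X : I -> bop H}.
Hypothesis vM : von_neumann_algebra M.
Hypothesis tauS : state_on M tau.
Hypothesis MX : forall i, M (X i).

Definition word_op (w : seq I) : bop H := \prod_(i <- w) X i.

Lemma word_op_mem w : M (word_op w).
Proof.
by rewrite /word_op; elim/big_ind: _ => //; [exact: vna_one|move=> *; exact: vna_mul].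
Qed.

Lemma tensmx_prod n (a : I -> 'M[R[i]]_n) (w : seq I) :
  \prod_(i <- w) tensmx (a i) (X i) = tensmx (\prod_(i <- w) a i) (word_op w).
Proof.
rewrite /word_op; elim: w => [|i w IHw].
  rewrite !big_nil; apply/matrixP => r s; rewrite !mxE.
  by case: eqP => _; rewrite ?scale1r ?scale0r.
rewrite !big_cons IHw; apply/matrixP => r s; rewrite !mxE scaler_suml.
apply: eq_bigr => j _; rewrite !mxE scale_mull scale_mulr scalerA //.
Qed.

Lemma tens_trace_expn n (a : I -> 'M[R[i]]_n) p :
  tens_trace tau ((\sum_i tensmx (a i) (X i)) ^+ p) =
    n%:R^-1 * word_trace (fun w => tau (word_op w)) p a.
Proof.
rewrite /tens_trace sum_expn; congr (_ * _); rewrite /word_trace /mxtrace.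
under [RHS]eq_bigr do rewrite mulr_suml.
rewrite exchange_big /=; apply: eq_bigr => r _.
rewrite summxE (state_sum vM tauS) => [|w].
  apply: eq_bigr => w _; rewrite tensmx_prod mxE (stateZ vM tauS)//; exact: word_op_mem.
by rewrite tensmx_prod mxE; apply: vnaZ => //; exact: word_op_mem.
Qed.

End TensorMoments.
Arguments word_op {R H I} X w.

Section MomentsFromDistributions.
Context {R : realType} {H K : hilbertType R} {k : nat}.
Context {M : set (bop H)} {N : set (bop K)} {X : 'I_k -> bop H} {Y : 'I_k -> bop K}.
Context {tau : bop H -> R[i]} {chi : bop K -> R[i]}.
Hypothesis vM : von_neumann_algebra M.
Hypothesis vN : von_neumann_algebra N.
Hypothesis MX : forall i, M (X i).
Hypothesis NY : forall i, N (Y i).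
Hypothesis tauS : state_on M tau.
Hypothesis chiS : state_on N chi.
Hypothesis tauT : tracial_on M tau.
Hypothesis chiT : tracial_on N chi.
Context {c d : R}.
Hypothesis c_lt_d : c < d.
Hypothesis same_dist : forall (n : nat) (a : 'I_k -> 'M[R[i]]_n), (0 < n)%N ->
  (forall i, a i \is hermsymmx) ->
  (forall i (l : R[i]), eigenvalue (a i) l -> c%:C <= l <= d%:C) ->
  same_distribution (tens_trace tau) (tens_trace chi)
    (\sum_(i < k) tensmx (a i) (X i)) (\sum_(i < k) tensmx (a i) (Y i)).

Let D (w : seq 'I_k) := tau (word_op X w) - chi (word_op Y w).

Lemma word_trace_spectrum p n (a : 'I_k -> 'M[R[i]]_n) : (0 < p)%N -> (0 < n)%N ->
  (forall i, hermitian (a i)) ->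
  (forall i (l : R[i]), eigenvalue (a i) l -> c%:C <= l <= d%:C) ->
  word_trace D p a = 0.
Proof.
move=> p0 n0 ah al.
have := same_dist n0 (fun i => hermitian_hermsymmx (ah i)) al p0.
rewrite (tens_trace_expn vM tauS MX) (tens_trace_expn vN chiS NY).
have nN0 : n%:R^-1 != 0 :> R[i] by rewrite invr_neq0// pnatr_eq0 -lt0n.
move/(mulfI nN0)/eqP; rewrite -subr_eq0 -sumrB => /eqP e; rewrite -[RHS]e.
by apply: eq_bigr => w _; rewrite mulrBr.
Qed.

(** For large m the matrices e + b_i / m, with e the midpoint, have spectrum in [c, d];
    homogeneity turns this into the vanishing of the word trace at b_i + m e, a
    polynomial in m, whose value at m = 0 is sought. *)
Lemma word_trace_hermitian p n (b : 'I_k -> 'M[R[i]]_n) : (0 < p)%N -> (0 < n)%N ->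
  (forall i, hermitian (b i)) -> word_trace D p b = 0.
Proof.
move=> p0 n0 bh; pose e := (c + d) / 2; pose rho := (d - c) / 2.
have rho0 : 0 < rho by rewrite divr_gt0// subr_gt0.
pose B := \sum_i entry_sum (b i).
have es0 i : 0 <= entry_sum (b i) by do 2 (apply: sumr_ge0 => ? _); exact: nrm_ge0.
have B0 : 0 <= B by exact: sumr_ge0.
have [m0 m0B] : exists m0 : nat, B / rho < m0%:R.
  by exists (Num.truncn (B / rho)).+1; exact: truncnS_gt.
suff /(_ 0) : forall s, word_trace D p (fun i => b i + s *: (e%:C)%:M) = 0.
  by under [X in X = _]eq_bigr do under eq_bigr do rewrite scale0r addr0.
apply: (word_trace_line (N := m0.+1)) => m m0m.
have m1 : 0 < m%:R :> R by rewrite ltr0n; exact: leq_trans m0m.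
have mN0 : m%:R != 0 :> R[i] by rewrite pnatr_eq0 -lt0n; exact: leq_trans m0m.
pose a i : 'M[R[i]]_n := (m%:R^-1) *: b i + (e%:C)%:M.
have aE i : b i + m%:R *: (e%:C)%:M = m%:R *: a i.
  by rewrite scalerDr scalerA mulfV// scale1r.
have -> : (fun i => b i + m%:R *: (e%:C)%:M) = (fun i => m%:R *: a i).
  by apply/funext.
rewrite word_trace_scale word_trace_spectrum ?mulr0// => [i r s|i l].
  rewrite !mxE [RHS]rmorphD [X in _ = X + _]rmorphM [X in _ = _ + X]rmorphMn /=.
  rewrite conj_real fmorphV /= conjC_nat -bh.
  by rewrite eq_sym.
case/eigenvalueP => v va v0.
have vb : v *m b i = (m%:R * (l - e%:C)) *: v.
  have -> : b i = m%:R *: (a i - (e%:C)%:M) by rewrite /a addrK scalerA mulfV// scale1r.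
  by rewrite -scalemxAr mulmxBr va mul_mx_scalar -scalerBl scalerA.
have [t tE tb] := hermitian_eigenvalue (bh i) vb v0.
have lE : l = e%:C + (t / m%:R)%:C.
  rewrite [X in _ = _ + X]rmorphM /= fmorphV /= rmorph_nat -tE mulrAC mulfV// mul1r.
  by rewrite addrC subrK.
have tm : `|t / m%:R| <= rho.
  rewrite normrM normfV (ger0_norm (ltW m1)) ler_pdivrMr//.
  apply: le_trans tb _; apply: le_trans (_ : B <= _).
    by rewrite /B (bigD1 i)//= lerDl sumr_ge0.
  rewrite mulrC -ler_pdivrMr//; apply: le_trans (ltW m0B) _.
  by rewrite ler_nat ltnW.
move: tm; rewrite ler_norml => /andP[t1 t2].
by rewrite lE -rmorphD !lecR /e; apply/andP; split; move: t1 t2; rewrite /rho => t1 t2; lra.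
Qed.

(** Polynomial in u, the word trace vanishes on x + u y for hermitian x, y and real u,
    hence also at u = i, which reaches every matrix. *)
Lemma word_trace_all p n (a : 'I_k -> 'M[R[i]]_n) : (0 < p)%N -> (0 < n)%N ->
  word_trace D p a = 0.
Proof.
move=> p0 n0; pose h : R[i] := (2^-1 : R)%:C.
have hh : h + h = 1 by rewrite -rmorphD; congr (_%:C); lra.
have iJ : (('i : R[i])^*)%R = - 'i by apply/eqP; rewrite eq_complex /= oppr0 !eqxx.
pose x i : 'M[R[i]]_n := \matrix_(r, s) (h * (a i r s + ((a i s r)^*)%R)).
pose y i : 'M[R[i]]_n := \matrix_(r, s) (- 'i * h * (a i r s - ((a i s r)^*)%R)).
have -> : a = (fun i => x i + 'i *: y i).
  apply/funext => i; apply/matrixP => r s; rewrite !mxE !mulrA mulrN -expr2 sqr_i opprK mul1r.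
  by rewrite -mulrDr addrACA subrr addr0 mulrDr -mulrDl hh mul1r.
apply: (word_trace_line (N := 0)) => m _; apply: word_trace_hermitian => // i r s.
rewrite !mxE !(rmorphD, rmorphM, rmorphN) /= !conjCK conjC_nat iJ conj_real opprK.
by ring.
Qed.

Lemma word_moments w : tau (word_op X w) = chi (word_op Y w).
Proof.
apply/eqP; rewrite -subr_eq0; apply/eqP; rewrite -/(D w).
case: w => [|i u]; first by rewrite /D /word_op !big_nil (state_one tauS) (state_one chiS) subrr.
have sz : size (i :: u) == (size u).+1 by [].
apply: (word_trace_eq0 (Tuple sz)) => [j v|a]; last exact: word_trace_all.
have rconsE (L : hilbertType R) (Z : 'I_k -> bop L) :
    word_op Z (rcons v j) = word_op Z v * Z j.
  by rewrite /word_op -cats1 big_cat big_seq1.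
have consE (L : hilbertType R) (Z : 'I_k -> bop L) :
    word_op Z (j :: v) = Z j * word_op Z v.
  by rewrite /word_op big_cons.
rewrite /D !rconsE !consE; congr (_ - _).
  exact: tauT (word_op_mem vM MX v) (MX j).
exact: chiT (word_op_mem vN NY v) (NY j).
Qed.

(** By induction on the pair (S, T), the equality of moments is propagated through
    arbitrary right factors A, B that already agree against all words; this form is
    stable under products, and A = B = 1 gives the result. *)
Lemma joint_trace S T : joint_alg X Y S T -> tau S = chi T.
Proof.
pose agree A B := forall w, tau (word_op X w * A) = chi (word_op Y w * B).
suff H0 : joint_alg X Y S T -> forall A B, M A -> N B -> agree A B -> agree (S * A) (T * B).
  move=> ST; have := H0 ST 1 1 (vna_one vM) (vna_one vN) _ [::].
  rewrite /word_op !big_nil !mul1r !mulr1; apply => w.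
  by rewrite !mulr1 word_moments.
elim=> {S T} [|i|a S S' T T' SS IS TT IT|S S' T T' SS IS TT IT] A B MA NB AB w.
- by rewrite !mul1r.
- by have := AB (rcons w i); rewrite /word_op -cats1 !big_cat !big_seq1 /= !mulrA.
- have MS := joint_mem vM MX SS; have MT := joint_mem vM MX TT.
  have NS := joint_mem vN NY (joint_sym SS); have NT := joint_mem vN NY (joint_sym TT).
  have MW := word_op_mem vM MX w; have NW := word_op_mem vN NY w.
  rewrite !mulrDl !scale_mull !mulrDr !scale_mulr.
  have vMM := vna_mul vM; have vNM := vna_mul vN.
  rewrite (state_linear tauS); [|exact: vMM MW (vMM _ _ MS MA)|exact: vMM MW (vMM _ _ MT MA)].
  rewrite (state_linear chiS); [|exact: vNM NW (vNM _ _ NS NB)|exact: vNM NW (vNM _ _ NT NB)].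
  by rewrite (IS A B MA NB AB w) (IT A B MA NB AB w).
- rewrite -!mulrA; apply: IS => //; last exact: IT.
    exact: (vna_mul vM) (joint_mem vM MX TT) MA.
  exact: (vna_mul vN) (joint_mem vN NY (joint_sym TT)) NB.
Qed.

End MomentsFromDistributions.

Theorem theorem2p1 (R : realType) (k : nat) (k_ge1 : (1 <= k)%N)
    (H K : hilbertType R) (M : set (bop H)) (N : set (bop K))
    (X : 'I_k -> bop H) (Y : 'I_k -> bop K)
    (X_sa : forall i, self_adjoint (X i)) (Y_sa : forall i, self_adjoint (Y i))
    (M_gen : vna_generated_by X M) (N_gen : vna_generated_by Y N)
    (tau : bop H -> R[i]) (chi : bop K -> R[i])
    (tauP : normal_faithful_tracial_state M tau)
    (chiP : normal_faithful_tracial_state N chi)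
    (c d : R) (c_lt_d : c < d)
    (same_dist : forall (n : nat) (a : 'I_k -> 'M[R[i]]_n), (0 < n)%N ->
      (forall i, a i \is hermsymmx) ->
      (forall i (l : R[i]), eigenvalue (a i) l -> c%:C <= l <= d%:C) ->
      same_distribution (tens_trace tau) (tens_trace chi)
        (\sum_(i < k) tensmx (a i) (X i)) (\sum_(i < k) tensmx (a i) (Y i))) :
  exists phi : bop H -> bop K,
    [/\ star_isomorphism M N phi,
        forall i, phi (X i) = Y i &
        forall T, M T -> chi (phi T) = tau T].
Proof.
apply: isomorphism_of_moments => // S T.
have [vM MX _] := M_gen; have [vN NY _] := N_gen.
exact: (joint_trace vM vN MX NY (nft_state tauP) (nft_state chiP)
  (nft_tracial tauP) (nft_tracial chiP) c_lt_d same_dist).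
Qed.
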